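(* Let $\Bbbk$ be a field, let $G$ be a nontrivial finite group with $\operatorname{char}\Bbbk\nmid |G|$, and let $R$ be a noetherian left $G$-module algebra over $\Bbbk$ with finite Gelfand–Kirillov dimension. Let $\mathfrak r=\mathfrak r(R,G)$ be the $G$-radical of $R$, $A=R^G$ and $\mathfrak a=A\cap\mathfrak r$. Assume that $\mathfrak a$ has the right Artin–Rees property and that $\mathfrak a$ and $\mathfrak r$ are cofinal. If $R$ is $G$-Cohen-Macaulay, i.e. $R^i\Gamma_{\mathfrak r}(R)=0$ for all $i\neq \mathsf p(R,G)$, then $A$ is $\mathfrak a$-Cohen-Macaulay of dimension $\mathsf p(R,G)$, i.e. $R^i\Gamma_{\mathfrak a}(A)=0$ for all $i\ne \mathsf p(R,G)$.
   Context: All algebras are $\Bbbk$-algebras; noetherian means left and right noetherian. A left $G$-module algebra $R$ is an algebra on which $G$ acts by $\Bbbk$-algebra automorphisms; $R^G$ is the subalgebra of invariants. Pertinent sequences and $G$-radical: sequences $(a_1,\dots,a_n)$, $(b_1,\dots,b_n)$ in $R$ are pertinent under the $G$-action if $\sum_{i}a_i(g\cdot b_i)=0$ for all $1\ne g\in G$. The $G$-radical is the two-sided ideal $\mathfrak r(R,G)=\{\sum_{i=1}^n a_ib_i : n\ge 1,\ (a_1,\dots,a_n),(b_1,\dots,b_n)\text{ pertinent under the }G\text{-action}\}$ of $R$. The pertinency is $\mathsf p(R,G)=\operatorname{GKdim}(R)-\operatorname{GKdim}(R/\mathfrak r(R,G))$. Right Artin–Rees (AR) property of an ideal $\mathfrak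 a$ of $A$: for every right ideal $\mathfrak c$ of $A$ there is $n$ with $\mathfrak c\cap\mathfrak a^n\subseteq\mathfrak c\mathfrak a$ (equivalently, for every finitely generated right $A$-module $M$ and submodule $N\subseteq M$, $N\cap M\mathfrak a^n\subseteq N\mathfrak a$ for some $n$). Cofinal: $\mathfrak a$ and $\mathfrak r$ are cofinal if (i) $\mathfrak aR=R\mathfrak a$, and (ii) for each $s$ there is an integer $n$ with $\mathfrak r^n\subseteq\mathfrak a^sR$. Local cohomology: for an ideal $\mathfrak s$ of a noetherian algebra $S$, $\Gamma_{\mathfrak s}=\varinjlim_n\operatorname{Hom}_S(S/\mathfrak s^n,-)$ on right $S$-modules, and $R^i\Gamma_{\mathfrak s}=\varinjlim_n\operatorname{Ext}^i_S(S/\mathfrak s^n,-)$ is its $i$-th right derived functor. *)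

(* Defs.v *)
From HB Require Import structures.
From mathcomp Require Import all_boot all_order all_algebra all_fingroup.
From mathcomp Require Import all_classical all_reals all_analysis.

Set Implicit Arguments.
Unset Strict Implicit.
Unset Printing Implicit Defensive.
Import Order.TTheory GRing.Theory Num.Theory.
Local Open Scope classical_set_scope.
Local Open Scope ring_scope.

(* Left G-module algebras. MathComp's {action _ &-> _} are right actions, hence
   this record; each act g is bijective with inverse act g^-1. *)

Record module_algebra (G : finGroupType) (k : fieldType) (R : algType k) :=
  ModuleAlgebra {
    mact :> G -> {lrmorphism R -> R};
    mact1 : forall x, mact 1%g x = x;
    mactM : forall g h x, mact (g * h)%g x = mact g (mact h x)
  }.

Definition fixed_by (G : finGroupType) (k : fieldType) (R : algType k)
    (act : module_algebra G R) : pred R :=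
  fun x => [forall g, act g x == x].

Lemma fixed_by_subalg (G : finGroupType) (k : fieldType) (R : algType k)
    (act : module_algebra G R) : subalg_closed (fixed_by act).
Proof.
split=> [|c x y /forallP hx /forallP hy|x y /forallP hx /forallP hy];
  apply/forallP=> g.
- by rewrite rmorph1.
- by rewrite linearP /= (eqP (hx g)) (eqP (hy g)).
- by rewrite rmorphM /= (eqP (hx g)) (eqP (hy g)).
Qed.

HB.instance Definition _ (G : finGroupType) (k : fieldType) (R : algType k)
    (act : module_algebra G R) :=
  GRing.isSubalgClosed.Build k R (fixed_by act) (fixed_by_subalg act).

(* R^G, with the algebra structure inherited from R. *)
Record invariants (G : finGroupType) (k : fieldType) (R : algType k)
    (act : module_algebra G R) := Invariants {
  inv_val : R;
  inv_valP : inv_val \in fixed_by act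
}.

HB.instance Definition _ (G : finGroupType) (k : fieldType) (R : algType k)
    (act : module_algebra G R) := [isSub for @inv_val G k R act].
HB.instance Definition _ (G : finGroupType) (k : fieldType) (R : algType k)
    (act : module_algebra G R) := [Choice of invariants act by <:].
HB.instance Definition _ (G : finGroupType) (k : fieldType) (R : algType k)
    (act : module_algebra G R) :=
  [SubChoice_isSubAlgebra of invariants act by <:].

Definition left_ideal (S : pzRingType) (I : set S) :=
  [/\ I 0, forall x y, I x -> I y -> I (x + y) & forall a x, I x -> I (a * x)].

Definition right_ideal (S : pzRingType) (I : set S) :=
  [/\ I 0, forall x y, I x -> I y -> I (x + y) & forall a x, I x -> I (x * a)].

Definition acc (T : Type) (P : set T -> Prop) :=
  forall I : nat -> set T, (forall n, P (I n)) ->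
    (forall n, I n `<=` I n.+1) ->
    exists N, forall n, (N <= n)%N -> I n = I N.

Definition noetherian (S : pzRingType) :=
  acc (@left_ideal S) /\ acc (@right_ideal S).

(* The additive subgroup spanned by the products x * y, x in I, y in J; it is
   used for additive subgroups I and J. *)
Definition set_mul (S : pzRingType) (I J : set S) : set S :=
  [set z | exists (n : nat) (x y : 'I_n -> S),
     (forall i, I (x i) /\ J (y i)) /\ z = \sum_(i < n) x i * y i].

Fixpoint set_pow (S : pzRingType) (I : set S) (n : nat) : set S :=
  if n is m.+1 then set_mul (set_pow I m) I else setT.

Definition right_artin_rees (S : pzRingType) (I : set S) :=
  forall C : set S, right_ideal C ->
    exists n, C `&` set_pow I n `<=` set_mul C I.

Definition pertinent (G : finGroupType) (k : fieldType) (R : algType k)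
    (act : module_algebra G R) (n : nat) (a b : 'I_n -> R) :=
  forall g : G, g != 1%g -> \sum_(i < n) a i * act g (b i) = 0.

Definition radical (G : finGroupType) (k : fieldType) (R : algType k)
    (act : module_algebra G R) : set R :=
  [set x | exists (n : nat) (a b : 'I_n -> R),
     [/\ (0 < n)%N, pertinent act a b & x = \sum_(i < n) a i * b i]].

Definition inv_radical (G : finGroupType) (k : fieldType) (R : algType k)
    (act : module_algebra G R) : set (invariants act) :=
  [set x | radical act (val x)].

Arguments inv_radical {G k R} act _.

Definition cofinal (G : finGroupType) (k : fieldType) (R : algType k)
    (act : module_algebra G R) (a : set (invariants act)) (r : set R) :=
  set_mul (val @` a) setT = set_mul setT (val @` a) /\
  forall s, exists n, set_pow r n `<=` set_mul (val @` set_pow a s) setT.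

Definition kspan (k : fieldType) (V : lmodType k) (X : set V) : set V :=
  [set v | exists (n : nat) (c : 'I_n -> k) (x : 'I_n -> V),
     (forall i, X (x i)) /\ v = \sum_(i < n) c i *: x i].

(* dim_k of the image in V / I of a subspace W of V; \bar Re because it may be
   infinite. *)
Definition dim_mod (Re : realType) (k : fieldType) (V : lmodType k)
    (I W : set V) : \bar Re :=
  ereal_sup [set (n%:R)%:E | n in [set n : nat | exists v : 'I_n -> V,
     (forall i, W (v i)) /\
     (forall c : 'I_n -> k, I (\sum_(i < n) c i *: v i) -> forall i, c i = 0)]].

(* If V is the span of s, this is k + V + ... + V^n. *)
Definition growth_space (k : fieldType) (R : algType k) (s : seq R) (n : nat) :
    set R :=
  kspan [set \prod_(x <- w) x | w in
           [set w : seq R | (size w <= n)%N /\ {subset w <= s}]].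

(* GKdim (R / I) for a two-sided ideal I: the finite-dimensional subspaces of
   R / I are the images of the spans of finite sequences s in R. The quotient is
   not formed because an algType is nonzero while I = R is allowed here; since
   lne 0 = -oo, the zero algebra has GKdim -oo. *)
Definition gkdim_mod (Re : realType) (k : fieldType) (R : algType k)
    (I : set R) : \bar Re :=
  ereal_sup [set limn_esup (fun n : nat =>
      (lne (dim_mod Re I (growth_space s n)) * ((ln n%:R)^-1)%:E)%E)
    | s in [set: seq R]].

Definition gkdim (Re : realType) (k : fieldType) (R : algType k) : \bar Re :=
  gkdim_mod Re [set 0 : R].

Definition pertinency (Re : realType) (G : finGroupType) (k : fieldType)
    (R : algType k) (act : module_algebra G R) : \bar Re :=
  (gkdim Re R - gkdim_mod Re (radical act))%E.

(* Right S-modules are left modules over the converse ring S^c: c *: m is m . c.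
   In particular S^c^o is S as a right module over itself. *)

Definition injective_module (S : pzRingType) (E : lmodType S^c) :=
  forall (M N : lmodType S^c) (f : {linear M -> N}) (g : {linear M -> E}),
    injective f -> exists h : {linear N -> E}, forall x, h (f x) = g x.

Record injective_resolution (S : pzRingType) (M : lmodType S^c) :=
  InjectiveResolution {
    ires : nat -> lmodType S^c;
    iaug : {linear M -> ires 0};
    idiff : forall i, {linear ires i -> ires i.+1};
    ires_inj : forall i, injective_module (ires i);
    iaug_inj : injective iaug;
    ires_exact0 : forall x, idiff 0 x = 0 <-> exists y, x = iaug y;
    ires_exact : forall i x, idiff i.+1 x = 0 <-> exists y, x = idiff i y
  }.

(* Hom_S(S / J, N), as the linear maps S -> N killing the right ideal J. For
   J' contained in J, the map induced by S / J' -> S / J is the inclusion. *)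
Definition hom_quot (S : pzRingType) (J : set S) (N : lmodType S^c) :
    set {linear S^c^o -> N} :=
  [set f | forall x, J x -> f x = 0].

(* Cocycles and coboundaries of the complex Hom_S(S / J, E), whose i-th
   cohomology is Ext^i_S(S / J, M). *)
Definition ext_cocycle (S : pzRingType) (M : lmodType S^c)
    (E : injective_resolution M) (J : set S) (i : nat) :
    set {linear S^c^o -> ires E i} :=
  [set f | hom_quot J f /\ forall x, idiff E i (f x) = 0].

Definition ext_coboundary (S : pzRingType) (M : lmodType S^c)
    (E : injective_resolution M) (J : set S) (i : nat) :
    set {linear S^c^o -> ires E i} :=
  match i with
  | 0%N => [set f | forall x, f x = 0]
  | j.+1 => [set f | exists2 g : {linear S^c^o -> ires E j},
                     hom_quot J g & forall x, f x = idiff E j (g x)]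
  end.

(* R^i Gamma_s (M) = colim_n Ext^i_S(S / s^n, M) is zero: the class of each
   cocycle at a stage n vanishes at some later stage m. Module
   categories have enough injectives and this condition does not depend on the
   choice of E, so quantifying over every E is the same as fixing one. *)
Definition local_cohomology_zero (S : pzRingType) (s : set S)
    (M : lmodType S^c) (i : nat) :=
  forall (E : injective_resolution M) (n : nat) (f : {linear S^c^o -> ires E i}),
    ext_cocycle (set_pow s n) f ->
    exists2 m, (n <= m)%N & ext_coboundary (set_pow s m) f.

Definition cohen_macaulay (Re : realType) (S : pzRingType) (s : set S)
    (p : \bar Re) :=
  forall i : nat, (i%:R)%:E != p -> local_cohomology_zero s S^c^o i.

(* Main.v *)
Require Import Defs.
From HB Require Import structures.
From mathcomp Require Import all_boot all_order all_algebra all_fingroup.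
From mathcomp Require Import all_classical all_reals all_analysis.

(* Let [A = R^G] and write [Gamma] for the torsion submodule. If [I] is an injective resolution
   of [A] over [A], vanishing of local cohomology in degree [i] says that the
   complex [Gamma I] is exact at [i], and for [i > 0] this is exactness at
   [i - 1] of the augmented complex [I / Gamma I]. The Artin-Rees property makes
   [Gamma] of an injective module injective, so the terms of [I / Gamma I] are
   torsion-free injective modules.

   Let [J] be an injective resolution of [R] over [R]. Since the radical is
   contained in a finitely generated right [A]-submodule of [R], the Artin-Rees
   property passes from [A] to the radical-adic filtration of [R], and the terms
   of [J / Gamma J] are again torsion-free injective over [R]. They are even
   injective over [A]: if [x = sum_i a_i b_i] with [a], [b] pertinent, then
   [v x = sum_i tr(v a_i) b_i], so off the radical a partial [A]-linear map
   extends uniquely to an [R]-linear one.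

   Hence [A -> R] and the Reynolds operator [R -> A] lift to maps between the
   complexes [I / Gamma I] and [J / Gamma J] whose composite on the first one is
   homotopic to the identity, and exactness descends from the second complex to
   the first. *)

Set Implicit Arguments.
Unset Strict Implicit.
Unset Printing Implicit Defensive.
Import GRing.Theory.
Local Open Scope classical_set_scope.
Local Open Scope ring_scope.

(** * Submodules and injectivity *)

Definition submodule (T : pzRingType) (V : lmodType T) (P : set V) :=
  P 0 /\ forall a x y, P x -> P y -> P (a *: x + y).

(** The proof [hP] is a parameter so that the closure instance below can be inferred from the
    predicate alone. *)
Definition submodule_pred (T : pzRingType) (V : lmodType T) (P : set V)
  (hP : submodule P) : pred V := fun x => `[< P x >].

Lemma submodule_pred_closed (T : pzRingType) (V : lmodType T) (P : set V)
  (hP : submodule P) : submod_closed (submodule_pred hP).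
Proof.
case: (hP) => P0 PD; split=> [|a x y /asboolP hx /asboolP hy]; apply/asboolP => //.
exact: PD.
Qed.

HB.instance Definition _ (T : pzRingType) (V : lmodType T) (P : set V)
  (hP : submodule P) :=
  GRing.isSubmodClosed.Build T V (submodule_pred hP) (submodule_pred_closed hP).

Record submodule_type (T : pzRingType) (V : lmodType T) (P : set V)
  (hP : submodule P) := SubmoduleType {
    submodule_val : V;
    submodule_valP : submodule_val \in submodule_pred hP }.

HB.instance Definition _ (T : pzRingType) (V : lmodType T) (P : set V)
  (hP : submodule P) := [isSub for @submodule_val T V P hP].
HB.instance Definition _ (T : pzRingType) (V : lmodType T) (P : set V)
  (hP : submodule P) := [Choice of submodule_type hP by <:].
HB.instance Definition _ (T : pzRingType) (V : lmodType T) (P : set V)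
  (hP : submodule P) := [SubChoice_isSubLmodule of submodule_type hP by <:].

Section Sub.
Variables (T : pzRingType) (V : lmodType T) (P : set V) (hP : submodule P).

Lemma submodule_mem (x : submodule_type hP) : P (val x).
Proof. by have /asboolP := valP x. Qed.

Definition to_submodule (x : V) (Px : P x) : submodule_type hP :=
  SubmoduleType (introT (asboolP _) Px : x \in submodule_pred hP).

Definition submodule_incl : {linear submodule_type hP -> V} := val.
End Sub.

Section Basic.
Variables (T : pzRingType) (V : lmodType T) (P : set V) (hP : submodule P).
Lemma submodule0 : P 0. Proof. by case: hP. Qed.
Lemma submoduleD x y : P x -> P y -> P (x + y).
Proof. by case: hP => _ + Px Py => /(_ 1 x y Px Py); rewrite scale1r. Qed.
Lemma submoduleZ a x : P x -> P (a *: x).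
Proof. by case: hP => P0 + Px => /(_ a x 0 Px P0); rewrite addr0. Qed.
Lemma submoduleN x : P x -> P (- x).
Proof. by move=> Px; rewrite -scaleN1r; apply: submoduleZ. Qed.
Lemma submoduleB x y : P x -> P y -> P (x - y).
Proof. by move=> Px Py; apply: submoduleD => //; apply: submoduleN. Qed.
End Basic.

Lemma make_linear (T : pzRingType) (U V : lmodType T) (f : U -> V) :
  (forall a x y, f (a *: x + y) = a *: f x + f y) ->
  exists h : {linear U -> V}, forall x, h x = f x.
Proof.
move=> hf; pose m := GRing.isLinear.Build T U V *:%R f hf.
by exists (HB.pack_for {linear U -> V} f m).
Qed.

Lemma regular_linearE (T : pzRingType) (V : lmodType T) (f : {linear T^o -> V}) (s : T) :
  f s = s *: f 1.
Proof. by rewrite -linearZ /=; congr (f _); rewrite /GRing.scale /= mulr1. Qed.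

Lemma scale_linear (T : pzRingType) (V : lmodType T) (x : V) :
  exists h : {linear T^o -> V}, forall s : T, h s = s *: x.
Proof. by apply: make_linear => a s t; rewrite scalerDl scalerA. Qed.

(* Injectivity in terms of graphs of partial linear maps, which avoids forming
   quotient modules. *)
Definition graph_extends (T : pzRingType) (N E : lmodType T) :=
  forall G : set (N * E), submodule G -> (forall y, G (0, y) -> y = 0) ->
  exists h : {linear N -> E}, forall x y, G (x, y) -> h x = y.

Lemma graph_uniq (T : pzRingType) (N E : lmodType T) (G : set (N * E)) :
  submodule G -> (forall y, G (0, y) -> y = 0) ->
  forall x y z, G (x, y) -> G (x, z) -> y = z.
Proof.
move=> hG G0 x y z Gy Gz; apply/eqP; rewrite -subr_eq0; apply/eqP/G0.
have -> : (0, y - z) = (x, y) - (x, z) :> N * E by rewrite -[in LHS](subrr x).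
exact: submoduleB.
Qed.

(** The graph [G] is itself a module: its first projection is injective because [G] is
    single-valued, and the second projection is the map to extend along it. *)
Lemma injective_graph (S : pzRingType) (E N : lmodType S^c) :
  injective_module E -> graph_extends N E.
Proof.
move=> injE G hG G0.
have [f fE] : exists f : {linear submodule_type hG -> N}, forall u, f u = (val u).1.
  by apply: make_linear => a x y; rewrite (linearP (submodule_incl hG)).
have [g gE] : exists g : {linear submodule_type hG -> E}, forall u, g u = (val u).2.
  by apply: make_linear => a x y; rewrite (linearP (submodule_incl hG)).
have injf : injective f.
  move=> u v; rewrite !fE => e; apply: val_inj.
  have := submodule_mem u; have := submodule_mem v; move: e.
  case: (val u) => u1 u2; case: (val v) => v1 v2 /= -> h1 h2.
  by congr pair; apply: graph_uniq h2 h1.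
have [h hE] := injE _ _ f g injf.
exists h => x y Gxy; have := hE (to_submodule hG Gxy).
by rewrite fE gE.
Qed.

Lemma graph_injective (S : pzRingType) (E : lmodType S^c) :
  (forall N : lmodType S^c, graph_extends N E) -> injective_module E.
Proof.
move=> ext M N f g injf.
have [||h hE] := ext N [set z | exists x, z = (f x, g x)].
- split; first by exists 0; rewrite !raddf0.
  by move=> a _ _ [x ->] [y ->]; exists (a *: x + y); rewrite !linearP.
- move=> y [x [] /esym e ->]; have -> : x = 0; rewrite ?raddf0 //.
  by apply: injf; rewrite raddf0.
- by exists h => x; apply: hE; exists x.
Qed.

(** Since the kernel of [f] is contained in that of [g], the pairs [(f x, g x)] form a single-valued
    graph, so no quotient by the kernel is needed. *)
Lemma injective_factor (S : pzRingType) (E M N : lmodType S^c)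
    (f : {linear M -> N}) (g : {linear M -> E}) :
  injective_module E -> (forall x, f x = 0 -> g x = 0) ->
  exists h : {linear N -> E}, forall x, h (f x) = g x.
Proof.
move=> injE fg.
have [||h hE] := injective_graph injE (G := [set z | exists x, z = (f x, g x)]).
- split; first by exists 0; rewrite !raddf0.
  by move=> a _ _ [x ->] [y ->]; exists (a *: x + y); rewrite !linearP.
- by move=> y [x [] /esym e ->]; exact: fg.
- by exists h => x; apply: hE; exists x.
Qed.

Lemma maximal_graph (T : pzRingType) (N E : lmodType T) (G : set (N * E)) :
  submodule G -> (forall y, G (0, y) -> y = 0) ->
  exists M : set (N * E), [/\ submodule M, (forall y, M (0, y) -> y = 0),
    G `<=` M & forall M', submodule M' -> (forall y, M' (0, y) -> y = 0) ->
      M `<=` M' -> M' `<=` M].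
Proof.
move=> hG G0.
(* The condition is put on the union with [G], so that it also holds for the empty set, the union of
   the empty chain. *)
pose P (X : set (N * E)) := submodule (X `|` G) /\
  forall y, (X `|` G) (0, y) -> y = 0.
have [|X [[hX X0] maxX]] := @Zorn_bigcup _ P.
  move=> F FP tot; set U := \bigcup_(X in F) X.
  (* Any two elements of the union already lie in one single-valued submodule, where closure can be
     checked. *)
  have common x y : (U `|` G) x -> (U `|` G) y -> exists Z : set (N * E),
      [/\ submodule Z, (forall y, Z (0, y) -> y = 0), Z x, Z y & Z `<=` U `|` G].
    have inU X : F X -> exists Z : set (N * E), [/\ submodule Z,
        (forall y, Z (0, y) -> y = 0), X `<=` Z, G `<=` Z & Z `<=` U `|` G].
      move=> FX; have [hX X0] := FP _ FX; exists (X `|` G).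
      split=> // z; try by [left|right].
      by case=> [Xz|]; [left; exists X|right].
    case=> [[X FX Xx]|Gx]; case=> [[Y FY Yy]|Gy].
    - have [/(_ _ Xx) Yx|/(_ _ Yy) Xy] := tot _ _ FX FY.
        by have [Z [? ? XZ GZ ?]] := inU _ FY; exists Z; split=> //; exact: XZ.
      by have [Z [? ? XZ GZ ?]] := inU _ FX; exists Z; split=> //; exact: XZ.
    - have [Z [? ? XZ GZ ?]] := inU _ FX; exists Z.
      by split=> //; first [exact: XZ|exact: GZ].
    - have [Z [? ? XZ GZ ?]] := inU _ FY; exists Z.
      by split=> //; first [exact: XZ|exact: GZ].
    - by exists G; split=> // z; right.
  split; last by move=> y Uy; have [Z [_ + Zy _ _]] := common _ _ Uy Uy; apply.
  split; first by (right; exact: submodule0).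
  move=> a x y Ux Uy; have [Z [hZ _ Zx Zy]] := common _ _ Ux Uy; apply.
  by case: hZ => _; apply.
exists (X `|` G); split=> //.
move=> M' hM' M'0 XM'; have M'G : M' `|` G = M'.
  by apply/setUidl => z Gz; apply: XM'; right.
have XsM' : X `<=` M' by move=> z Xz; apply: XM'; left.
apply: contrapT => nM'; apply: (maxX M'); last by rewrite /P M'G.
by split=> // M'X; apply: nM' => z /M'X; left.
Qed.

(** Baer's criterion. A maximal graph [M] is defined at every [z]: the scalars [s] with [s *: z] in
    its domain form an ideal, and the map this ideal carries extends to the whole ring, which gives
    a value [h 1] for [z]. *)
Lemma baer (T : pzRingType) (E : lmodType T) :
  graph_extends T^o E -> forall N : lmodType T, graph_extends N E.
Proof.
move=> extT N G hG G0.
have [M [hM M0 GM maxM]] := maximal_graph hG G0.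
have total z : exists y, M (z, y).
  pose C : set (T^o * E) := [set u | M (u.1 *: z, u.2)].
  have hC : submodule C.
    split; first by (rewrite /C /= scale0r; exact: (submodule0 hM)).
    move=> a [x1 x2] [y1 y2]; rewrite /C /= => hx hy.
    have := (hM.2 a _ _ hx hy); rewrite /C /=.
    by rewrite scalerDl -scalerA.
  have [|h hE] := extT C hC; first by move=> y; rewrite /C /= scale0r; exact: M0.
  pose M' : set (N * E) := [set u | exists v (s : T), M v /\ u = v + s *: (z, h 1)].
  have hM' : submodule M'.
    split; first by exists 0, 0; split; [exact: (submodule0 hM)|rewrite scale0r addr0].
    move=> a _ _ [v [s [Mv ->]]] [w [t [Mw ->]]].
    exists (a *: v + w), (a * s + t); split; first exact: hM.2.
    by rewrite scalerDr scalerDl !scalerA addrACA.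
  (* If [u + s *: z = 0], then [- s] lies in the ideal, so [v] is [- s *: h 1] and the two
     contributions cancel. *)
  have M'0 y : M' (0, y) -> y = 0.
    case=> -[u v] [s [Muv]] [] e1 ->.
    have : C (- s, v).
      rewrite /C /= scaleNr (_ : - (s *: z) = u) //.
      by apply/esym/eqP; rewrite -addr_eq0 -e1.
    by move/hE; rewrite regular_linearE scaleNr => <-; rewrite addNr.
  have MM' : M `<=` M' by move=> v Mv; exists v, 0; rewrite scale0r addr0.
  exists (h 1); apply: (maxM _ hM' M'0 MM').
  by exists 0, 1; split; [exact: (submodule0 hM)|rewrite scale1r add0r].
have [f fE] := choice total.
have [h hE] : exists h : {linear N -> E}, forall x, h x = f x.
  apply: make_linear => a x y; apply: (graph_uniq hM M0 (fE _)).
  exact: (hM.2 a _ _ (fE x) (fE y)).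
by exists h => x y /GM Mxy; rewrite hE; apply: (graph_uniq hM M0 (fE x)).
Qed.

(** * Restriction and coinduction *)

(** Restriction of scalars as an alias of [M]: the elements stay the same and only the scaling
    changes. *)
Definition restriction (S T : pzRingType) (u : {rmorphism S -> T})
  (M : lmodType T^c) : Type := M.

Section Restriction.
Variables (S T : pzRingType) (u : {rmorphism S -> T}) (M : lmodType T^c).

Local Notation restriction := (restriction u M).

HB.instance Definition _ := GRing.Zmodule.copy restriction M.

Definition restriction_scale (c : S^c) (x : restriction) : restriction :=
  (u c : T^c) *: (x : M).

Fact restriction_scaleA a b x :
  restriction_scale a (restriction_scale b x) = restriction_scale (a * b) x.
Proof. by rewrite /restriction_scale scalerA; congr (_ *: _); rewrite [RHS]rmorphM. Qed.
Fact restriction_scale1 : left_id 1 restriction_scale.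
Proof. by move=> x; rewrite /restriction_scale [u _]rmorph1 scale1r. Qed.
Fact restriction_scaleDr : right_distributive restriction_scale +%R.
Proof. by move=> a x y; rewrite /restriction_scale scalerDr. Qed.
Fact restriction_scaleDl x : {morph restriction_scale^~ x : a b / a + b}.
Proof. by move=> a b; rewrite /restriction_scale [u _]rmorphD scalerDl. Qed.

HB.instance Definition _ := GRing.Zmodule_isLmodule.Build S^c restriction
  restriction_scaleA restriction_scale1 restriction_scaleDr restriction_scaleDl.

Lemma restrictionZ (c : S^c) (x : restriction) : c *: x = (u c : T^c) *: (x : M).
Proof. by []. Qed.
End Restriction.

(** By Baer's criterion only ideals of [K] matter. If one contains some [s] that is not zero, with
    value [y], the extension sends [x] to the multiple of [y] by [s^-1 * x]; otherwise zero
    works. *)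
Lemma field_graph (K : fieldType) (N E : lmodType K^c) : graph_extends N E.
Proof.
apply: baer => G hG G0.
have [[[s y] [Gsy sN0]]|nG] := pselect (exists z : K^c^o * E, G z /\ z.1 <> 0).
  pose q (x : K) : K := (s : K)^-1 * x.
  have [h hE] : exists h : {linear K^c^o -> E}, forall x : K, h x = (q x : K^c) *: y.
    apply: make_linear => a x z; rewrite scalerA -scalerDl; congr (_ *: _).
    pose x' : K := x; pose a' : K := a; pose z' : K := z; pose s' : K := s.
    change (s'^-1 * (x' * a' + z') = (s'^-1 * x') * a' + s'^-1 * z').
    by rewrite mulrDr mulrA.
  exists h => x z Gxz; rewrite hE.
  apply: (graph_uniq hG G0 _ Gxz).
  have := submoduleZ hG (q x : K^c) Gsy.
  suff -> : (q x : K^c) *: (s, y) = (x, (q x : K^c) *: y) by [].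
  congr pair; have -> : (q x : K^c) *: s = (s : K) * q x by [].
  by rewrite mulVKf //; apply/eqP.
exists (\0) => x y Gxy; apply/esym/G0.
by have <- : x = 0 by apply: contrapT => x0; apply: nG; exists (x, y).
Qed.

Section Coinduced.
Variables (K : fieldType) (T : pzRingType) (u : {rmorphism K -> T}).

(** These are the elements of $\operatorname{Hom}_K(T, M)$ for the right $K$-structures given by
    [u]. The right $T$-action defined below is $(\varphi r)(x) = \varphi(r x)$. *)
Definition coind_pred (M : lmodType T^c) : pred (T -> M) := fun phi =>
  `[< forall c x y, phi (x * u c + y) = (u c : T^c) *: phi x + phi y >].

Lemma coind_closed (M : lmodType T^c) : zmod_closed (@coind_pred M).
Proof.
split; first by apply/asboolP => c x y; rewrite scaler0 addr0.
move=> f g /asboolP hf /asboolP hg; apply/asboolP => c x y.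
rewrite /GRing.add /= /GRing.opp /=.
by rewrite hf hg scalerBr opprD addrACA.
Qed.

HB.instance Definition _ (M : lmodType T^c) :=
  GRing.isZmodClosed.Build _ (@coind_pred M) (coind_closed M).

Record coind (M : lmodType T^c) :=
  Coind { coind_fun : T -> M; coind_funP : coind_fun \in @coind_pred M }.

HB.instance Definition _ (M : lmodType T^c) := [isSub for @coind_fun M].
HB.instance Definition _ (M : lmodType T^c) := [Choice of coind M by <:].
HB.instance Definition _ (M : lmodType T^c) :=
  [SubChoice_isSubZmodule of coind M by <:].

Variable M : lmodType T^c.

Lemma coindE (phi : coind M) c x y :
  val phi (x * u c + y) = (u c : T^c) *: val phi x + val phi y.
Proof. by have /asboolP := coind_funP phi; apply. Qed.

Lemma coindD (phi psi : coind M) x : val (phi + psi) x = val phi x + val psi x.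
Proof. by rewrite raddfD. Qed.

Lemma coind0 x : val (0 : coind M) x = 0.
Proof. by rewrite raddf0. Qed.

Lemma coind_addr (phi : coind M) x y : val phi (x + y) = val phi x + val phi y.
Proof. by have := coindE phi 1 x y; rewrite rmorph1 mulr1 scale1r. Qed.

Lemma coindM (phi : coind M) c x : val phi (x * u c) = (u c : T^c) *: val phi x.
Proof.
have phi0 : val phi 0 = 0.
  by apply: (addIr (val phi 0)); rewrite -coind_addr addr0 add0r.
by have := coindE phi c x 0; rewrite phi0 !addr0.
Qed.

Fact coind_scale_subproof (r : T^c) (phi : coind M) :
  (fun x : T => val phi ((r : T) * x)) \in @coind_pred M.
Proof. by apply/asboolP => c x y; rewrite mulrDr mulrA coindE. Qed.

Definition coind_scale (r : T^c) (phi : coind M) : coind M :=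
  Coind (coind_scale_subproof r phi).

Lemma coind_eq (phi psi : coind M) : val phi =1 val psi -> phi = psi.
Proof. by move=> e; apply/val_inj/funext. Qed.

Fact coind_scaleA a b phi : coind_scale a (coind_scale b phi) = coind_scale (a * b) phi.
Proof. by apply: coind_eq => x /=; rewrite mulrA. Qed.
Fact coind_scale1 : left_id 1 coind_scale.
Proof. by move=> phi; apply: coind_eq => x /=; rewrite mul1r. Qed.
Fact coind_scaleDr : right_distributive coind_scale +%R.
Proof.
by move=> a phi psi; apply: coind_eq => x; rewrite [RHS]coindD; exact: coindD.
Qed.
Fact coind_scaleDl phi : {morph coind_scale^~ phi : a b / a + b}.
Proof. by move=> a b; apply: coind_eq => x; rewrite coindD /= mulrDl coind_addr. Qed.

HB.instance Definition _ := GRing.Zmodule_isLmodule.Build T^c (coind M)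
  coind_scaleA coind_scale1 coind_scaleDr coind_scaleDl.

Lemma coindZ (r : T^c) (phi : coind M) x : val (r *: phi) x = val phi ((r : T) * x).
Proof. by []. Qed.

(** One direction of the adjunction between restriction and coinduction. *)
Lemma coind_linear (N : lmodType T^c)
    (t : {linear restriction u N -> restriction u M}) :
  exists h : {linear N -> coind M}, forall x r, val (h x) r = t ((r : T^c) *: x).
Proof.
have sub x : (fun r : T => t ((r : T^c) *: x)) \in @coind_pred M.
  apply/asboolP => c r s; rewrite scalerDl raddfD; congr (_ + _).
  by rewrite -[RHS]restrictionZ -linearZ /= restrictionZ scalerA.
have [h hE] : exists h : {linear N -> coind M}, forall x, h x = Coind (sub x).
  apply: make_linear => a x y; apply: coind_eq => r; rewrite coindD coindZ /=.
  by rewrite scalerDr raddfD scalerA.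
by exists h => x r; rewrite hE.
Qed.

(** Evaluation at 1 turns a partial $T$-linear map into a partial $K$-linear one, which extends over
    the field; the adjunction carries the extension back. *)
Lemma coind_injective : injective_module (coind M).
Proof.
apply: graph_injective => N G hG G0.
pose H : set (restriction u N * restriction u M) :=
  [set z | exists2 phi : coind M, G (z.1, phi) & z.2 = val phi 1].
have [||t tE] := @field_graph K (restriction u N) (restriction u M) H.
- split; first by exists 0; [exact: (submodule0 hG)|].
  move=> a [x x'] [y y'] [phi /= Gx ->] [psi /= Gy ->].
  exists ((u a : T^c) *: phi + psi); first exact: (hG.2 (u a) _ _ Gx Gy).
  by have := coindM phi a 1; rewrite mul1r coindD coindZ mulr1 => ->.
- by move=> y [phi /= /G0 -> ->].
have [h hE] := coind_linear t.
exists h => x phi Gx; apply: coind_eq => r; rewrite hE.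
by rewrite (tE _ (val phi r)) //; exists ((r : T^c) *: phi);
  [exact: (submoduleZ hG r Gx)|rewrite coindZ mulr1].
Qed.
End Coinduced.

(** * Existence of injective resolutions *)

Lemma submodule_range (T : pzRingType) (V W : lmodType T) (f : {linear V -> W}) :
  submodule (range f).
Proof.
split; first by exists 0; rewrite ?raddf0.
by move=> a _ _ [x _ <-] [y _ <-]; exists (a *: x + y); rewrite ?linearP.
Qed.

Lemma restriction_submodule (S T : pzRingType) (u : {rmorphism S -> T})
  (N : lmodType T^c) (P : set N) : submodule P -> @submodule S^c (restriction u N) P.
Proof.
by move=> hP; split=> [|a x y Px Py]; [exact: (submodule0 hP)|exact: hP.2].
Qed.

Section InjectiveResolution.
Variables (K : fieldType) (T : pzRingType) (u : {rmorphism K -> T}).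

(* Over the field [K], [P] has a complement in [N]; the projection [t] onto it
   yields [d x r = t (x r)], which is [T]-linear with kernel [P]. *)
Lemma coind_kernel (N : lmodType T^c) (P : set N) : submodule P ->
  exists d : {linear N -> coind u N}, forall x, d x = 0 <-> P x.
Proof.
move=> hP; have hP' := restriction_submodule u hP.
have [||q qE] := @field_graph K (restriction u N) (submodule_type hP')
    [set z | z.1 = val z.2].
- split; first exact/esym/(raddf0 (submodule_incl hP')).
  by move=> a [x x'] [y y'] /= -> ->; exact/esym/(linearP (submodule_incl hP')).
- move=> y /= y0; apply: val_inj; rewrite -[LHS]y0.
  exact/esym/(raddf0 (submodule_incl hP')).
have [t tE] : exists t : {linear restriction u N -> restriction u N},
    forall x, t x = x - val (q x).
  apply: make_linear => a x y.
  by rewrite linearP (linearP (submodule_incl hP')) scalerBr addrACA -opprD.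
have t0 x : P x -> t x = 0.
  by move=> Px; rewrite tE (qE x (to_submodule hP' Px)) // subrr.
have [d dE] := coind_linear t.
exists d => x; split=> [d0|Px].
  have : t x = 0.
    by have := dE x 1; rewrite d0 coind0 scale1r.
  by rewrite tE => /eqP; rewrite subr_eq0 => /eqP ->; exact: submodule_mem.
by apply: coind_eq => r; rewrite dE coind0 t0 //; exact: (submoduleZ hP).
Qed.

Variable M : lmodType T^c.

Fixpoint coind_iter (i : nat) : lmodType T^c :=
  if i is j.+1 then coind u (coind_iter j) else coind u M.

(** Each differential is chosen with kernel equal to the range of the preceding map, so exactness
    holds by construction and no cokernel is formed. *)
Lemma injective_resolution_exists : inhabited (injective_resolution M).
Proof.
have sub0 : submodule [set 0 : M].
  by split=> // a x y -> ->; rewrite /= scaler0 addr0.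
have [aug augE] := coind_kernel sub0.
pose step (V W : lmodType T^c) (f : {linear V -> W}) : {linear W -> coind u W} :=
  projT1 (cid (coind_kernel (submodule_range f))).
have stepE (V W : lmodType T^c) (f : {linear V -> W}) x :
    step V W f x = 0 <-> exists y, x = f y.
  rewrite (projT2 (cid (coind_kernel (submodule_range f))) x).
  by split=> [[y _ <-]|[y ->]]; exists y.
pose d := fix d i : {linear coind_iter i -> coind_iter i.+1} :=
  match i with 0%N => step _ _ aug | j.+1 => step _ _ (d j) end.
constructor; apply: (@InjectiveResolution T M coind_iter aug d).
- by case=> [|i]; exact: coind_injective.
- move=> x y e; apply/eqP; rewrite -subr_eq0; apply/eqP/augE.
  by rewrite raddfB /= [aug x]e subrr.
- exact: stepE.
- by move=> i; exact: stepE.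
Qed.
End InjectiveResolution.

(** * Artin-Rees filtrations and torsion *)

Section SetMul.
Variable S : pzRingType.
Implicit Types I J K : set S.

Lemma set_mul_sub I J K : K 0 -> (forall x y, K x -> K y -> K (x + y)) ->
  (forall x y, I x -> J y -> K (x * y)) -> set_mul I J `<=` K.
Proof.
move=> K0 KD IJK _ [n [x [y [xy ->]]]]; elim/big_ind: _ => // i _.
by have [] := xy i; exact: IJK.
Qed.

Lemma set_mulM I J x y : I x -> J y -> set_mul I J (x * y).
Proof.
move=> Ix Jy; exists 1%N, (fun=> x), (fun=> y); split=> //.
by rewrite big_ord1.
Qed.

Lemma set_mul0 I J : set_mul I J 0.
Proof. by exists 0%N, (fun=> 0), (fun=> 0); split=> [[]//|]; rewrite big_ord0. Qed.

Lemma set_mulD I J x y : set_mul I J x -> set_mul I J y -> set_mul I J (x + y).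
Proof.
move=> [n [a [b [ab ->]]]] [m [c [d [cd ->]]]].
pose g (T : Type) (f1 : 'I_n -> T) (f2 : 'I_m -> T) (i : 'I_(n + m)) :=
  match fintype.split i with inl j => f1 j | inr j => f2 j end.
exists (n + m)%N, (g S a c), (g S b d); split.
  by move=> i; rewrite /g; case: fintype.split.
rewrite big_split_ord /=; congr (_ + _); apply: eq_bigr => i _.
  by rewrite /g (unsplitK (inl i)).
by rewrite /g (unsplitK (inr i)).
Qed.

Lemma set_mulS I I' J J' : I `<=` I' -> J `<=` J' -> set_mul I J `<=` set_mul I' J'.
Proof.
move=> II JJ; apply: set_mul_sub => [|x y|x y Ix Jy].
- exact: set_mul0.
- exact: set_mulD.
by apply: set_mulM; [exact: II|exact: JJ].
Qed.

Lemma set_mulA I J K : set_mul (set_mul I J) K `<=` set_mul I (set_mul J K).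
Proof.
apply: set_mul_sub => [|x y|x y IJx Ky]; [exact: set_mul0|exact: set_mulD|].
move: x IJx; apply: set_mul_sub => [|x z|x z Ix Jz]; rewrite ?mul0r ?mulrDl -?mulrA.
- exact: set_mul0.
- exact: set_mulD.
- by apply: set_mulM => //; exact: set_mulM.
Qed.

Lemma set_mul_right_ideal I J : right_ideal J -> right_ideal (set_mul I J).
Proof.
case=> _ _ JM; split; [exact: set_mul0|exact: set_mulD|] => a.
apply: set_mul_sub => [|x y|x y Ix Jy]; rewrite ?mul0r ?mulrDl -?mulrA.
- exact: set_mul0.
- exact: set_mulD.
- by apply: set_mulM => //; exact: JM.
Qed.

Lemma set_mul_left_ideal I J : left_ideal I -> left_ideal (set_mul I J).
Proof.
case=> _ _ IM; split; [exact: set_mul0|exact: set_mulD|] => a.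
apply: set_mul_sub => [|x y|x y Ix Jy]; rewrite ?mulr0 ?mulrDr ?mulrA.
- exact: set_mul0.
- exact: set_mulD.
- by apply: set_mulM => //; exact: IM.
Qed.

Lemma set_pow_left_ideal I n : left_ideal I -> left_ideal (set_pow I n).
Proof. by move=> hI; elim: n => [|n IHn] //=; exact: set_mul_left_ideal. Qed.

Lemma set_pow_right_ideal I n : right_ideal I -> right_ideal (set_pow I n).
Proof. by case: n => [|n] hI //=; exact: set_mul_right_ideal. Qed.

Lemma set_powSW I n : right_ideal I -> set_pow I n.+1 `<=` set_pow I n.
Proof.
move=> hI; have [? ? IM] := set_pow_right_ideal n hI.
by apply: set_mul_sub => // x y Ix _; exact: IM.
Qed.

Lemma set_pow_leq I m n : right_ideal I -> (m <= n)%N -> set_pow I n `<=` set_pow I m.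
Proof.
move=> hI /subnK <-; elim: (n - m)%N => [|d IHd] //.
by move=> x /(set_powSW hI) /IHd.
Qed.

Lemma set_pow1 I : left_ideal I -> set_pow I 1 `<=` I.
Proof. by case=> ? ? IM; apply: set_mul_sub => // x y _; exact: IM. Qed.

Lemma set_pow_add I m n : set_pow I (m + n) `<=` set_mul (set_pow I m) (set_pow I n).
Proof.
elim: n => [|n IHn].
  by move=> x; rewrite addn0 -[x in set_mul _ _ x]mulr1 => Ix; exact: set_mulM.
by rewrite addnS => x Ix; apply: set_mulA; move: x Ix; exact: set_mulS.
Qed.
End SetMul.

Section Torsion.
Variables (S : pzRingType) (B : nat -> set S).

(** For [B n] the powers of an ideal this is $\Gamma(N)$, with $\operatorname{Hom}_S(S/B_n, N)$ read
    as the elements killed by $B_n$. *)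
Definition torsion (N : lmodType S^c) : set N :=
  [set x | exists n, forall b, B n b -> (b : S^c) *: x = 0].

(** The inclusion is asked for every [B s], since torsion elements are killed by arbitrary members
    of the filtration. *)
Definition artin_rees_filtration :=
  [/\ forall n, left_ideal (B n), forall n, right_ideal (B n),
      forall n, B n.+1 `<=` B n &
      forall C, right_ideal C -> forall s, exists n,
        C `&` B n `<=` set_mul C (B s)].

Lemma torsion_linear (M N : lmodType S^c) (f : {linear M -> N}) x :
  torsion x -> torsion (f x).
Proof. by case=> n hn; exists n => b /hn e; rewrite -linearZ /= e raddf0. Qed.

Lemma filtration_leq m n : (forall n, B n.+1 `<=` B n) -> (m <= n)%N -> B n `<=` B m.
Proof.
by move=> hB /subnK <-; elim: (n - m)%N => [|d IHd] // x /hB /IHd.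
Qed.

Lemma torsion_submodule (N : lmodType S^c) :
  (forall n, left_ideal (B n)) -> (forall n, B n.+1 `<=` B n) ->
  submodule (@torsion N).
Proof.
move=> hL hB; split=> [|a x y [m hx] [n hy]].
  by exists 0%N => b _; rewrite scaler0.
exists (maxn m n) => b Bb; rewrite scalerDr scalerA.
rewrite hy; last by move: b Bb; apply: filtration_leq (leq_maxr _ _).
rewrite addr0 hx //; have [_ _ +] := hL m; apply.
by move: b Bb; apply: filtration_leq (leq_maxl _ _).
Qed.

Hypothesis noethS : acc (@right_ideal S).
Hypothesis AR : artin_rees_filtration.

Let torsion_sub (N : lmodType S^c) : submodule (@torsion N).
Proof. by case: AR => *; apply: torsion_submodule. Qed.

(** By Baer's criterion, take a partial map from a right ideal to the torsion. Noetherianity bounds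
    the torsion of all its values at once, and the Artin-Rees property then makes it zero on the
    part of its domain inside some [B n]. Extended by zero on [B n], it has an extension to [E]
    whose value at 1 is torsion. *)
Lemma torsion_injective (E : lmodType S^c) : injective_module E ->
  injective_module (submodule_type (torsion_sub E)).
Proof.
case: AR => BL BR Bdec BAR injE; apply: graph_injective; apply: baer => G hG G0.
(* Arguments whose value is killed by [B s]: an ascending chain of right ideals, stable from some
   [N] on. *)
pose C (s : nat) : set S := [set c | exists y,
  G (c, y) /\ forall b, B s b -> (b : S^c) *: val y = 0].
have CR s : right_ideal (C s).
  split.
  - by exists 0; split=> [|b _]; [exact: (submodule0 hG)|rewrite scaler0].
  - move=> x y [x' [Gx hx]] [y' [Gy hy]]; exists (x' + y'); split.
      exact: (submoduleD hG Gx Gy).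
    move=> b Bb; have -> : val (x' + y') = val x' + val y' by [].
    by rewrite scalerDr hx // hy // addr0.
  - move=> a x [x' [Gx hx]]; exists ((a : S^c) *: x'); split.
      exact: (submoduleZ hG (a : S^c) Gx).
    move=> b Bb; have -> : val ((a : S^c) *: x') = (a : S^c) *: val x' by [].
    by rewrite scalerA hx //; have [_ _] := BL s; apply.
have Cinc s : C s `<=` C s.+1.
  by move=> c [y [Gy hy]]; exists y; split=> // b /Bdec /hy.
have [N hN] := noethS CR Cinc.
have CN c y : G (c, y) -> C N c.
  move=> Gcy; have [s hs] := submodule_mem y.
  have : C s c by exists y.
  case: (leqP N s) => [/hN -> //|/ltnW sN].
  have : C s `<=` C N.
    by move: sN => /subnK <-; elim: (N - s)%N => [|d IHd] // x /IHd /Cinc.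
  by apply.
have [n hn] := BAR _ (CR N) N.
have val0 : val (0 : submodule_type (torsion_sub E)) = 0.
  exact: (raddf0 (submodule_incl (torsion_sub E))).
have killed : set_mul (C N) (B N) `<=` [set c | G (c, 0)].
  apply: set_mul_sub => [|x y Gx Gy|x y [x' [Gx hx]] By].
  - exact: (submodule0 hG).
  - by have := submoduleD hG Gx Gy; congr G; congr pair; rewrite addr0.
  - have := submoduleZ hG (y : S^c) Gx; congr G; congr pair; apply: val_inj.
    by rewrite val0 -(hx _ By).
(* The map extended by zero on [B n]. It is single-valued because the map vanishes on [C N]
   multiplied by [B N], which contains the intersection of [C N] and [B n]. *)
pose G' : set (S^c^o * E) := [set z | exists c b y,
  [/\ G (c, y), B n b & z = (c + b, val y)]].
have [||h hE] := injective_graph injE (N := S^c^o) (G := G').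
- split.
    exists 0, 0, 0; split; [exact: (submodule0 hG)|by case: (BL n)|].
    by rewrite addr0 val0.
  move=> a _ _ [c [b [y [Gc Bb ->]]]] [c' [b' [y' [Gc' Bb' ->]]]].
  exists (a *: c + c'), ((b : S) * (a : S) + b'), (a *: y + y'); split.
  - exact: (hG.2 a _ _ Gc Gc').
  - by case: (BR n) => _ BD BM; apply: BD => //; exact: BM.
  - rewrite (linearP (submodule_incl (torsion_sub E))).
    congr pair; pose d : S^c^o := b; pose d' : S^c^o := b'.
    change (a *: (c + d) + (c' + d') = a *: c + c' + (a *: d + d')).
    by rewrite scalerDr addrACA.
- move=> y [c [b [y' [Gc Bb [/esym cb ->]]]]].
  have Bc : B n c.
    have -> : c = b * (-1) by rewrite mulrN1; apply/eqP; rewrite -addr_eq0 cb.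
    by case: (BR n) => _ _; apply.
  have -> : y' = 0.
    by apply: (graph_uniq hG G0 Gc); apply/killed/hn; split=> //; exact: CN Gc.
  exact: val0.
have te : torsion (h 1).
  exists n => b Bb; rewrite -regular_linearE; apply: hE.
  exists 0, b, 0; split=> //; first exact: (submodule0 hG).
  by rewrite add0r val0.
have [k kE] := scale_linear (to_submodule (torsion_sub E) te).
exists k => x y Gxy; rewrite kE; apply: val_inj.
have -> : val (x *: to_submodule (torsion_sub E) te) = x *: h 1 by [].
rewrite -regular_linearE; apply: hE; exists x, 0, y; split=> //; last by rewrite addr0.
by case: (BL n).
Qed.

(** The identity of the torsion extends to a retraction [q] of [E], and [p = 1 - q]. Thus the image
    of [p] stands for the quotient of [E] by its torsion. *)
Lemma torsion_projection (E : lmodType S^c) : injective_module E ->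
  exists p : {linear E -> E},
    (forall x, p x = 0 <-> torsion x) /\ forall x, p (p x) = p x.
Proof.
move=> injE; set hT := torsion_sub E.
have [||q qE] := injective_graph (torsion_injective injE) (N := E)
    (G := [set z | z.1 = val z.2]).
- split; first exact/esym/(raddf0 (submodule_incl hT)).
  by move=> a [x x'] [y y'] /= -> ->; exact/esym/(linearP (submodule_incl hT)).
- move=> y /= y0; apply: val_inj; rewrite -[LHS]y0.
  exact/esym/(raddf0 (submodule_incl hT)).
have [p pE] : exists p : {linear E -> E}, forall x, p x = x - val (q x).
  apply: make_linear => a x y.
  by rewrite linearP (linearP (submodule_incl hT)) scalerBr addrACA -opprD.
have p0 x : p x = 0 <-> torsion x.
  rewrite pE; split=> [/eqP|Tx].
    by rewrite subr_eq0 => /eqP ->; exact: submodule_mem.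
  by rewrite (qE x (to_submodule hT Tx)) // subrr.
exists p; split=> // x.
have e : p (x - val (q x)) = p x.
  by rewrite raddfB /= [p (val _)](iffRL (p0 _)) ?subr0 //; exact: submodule_mem.
by move: (e); rewrite -pE.
Qed.
End Torsion.

(** * Complexes modulo torsion *)

Section Comparison.
Variables (S : pzRingType) (B : nat -> set S).
Hypothesis torsB : forall N : lmodType S^c, submodule (@torsion S B N).
Local Notation torsion := (torsion B).

Lemma torsion_trans (N : lmodType S^c) (y x z : N) :
  torsion (x - y) -> torsion (y - z) -> torsion (x - z).
Proof. by move=> h1 h2; have := submoduleD (torsB N) h1 h2; rewrite addrA subrK. Qed.

Lemma torsion_sym (N : lmodType S^c) (x y : N) : torsion (x - y) -> torsion (y - x).
Proof. by move/(submoduleN (torsB N)); rewrite opprB. Qed.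

Lemma torsion_map (M N : lmodType S^c) (f : {linear M -> N}) x y :
  torsion (x - y) -> torsion (f x - f y).
Proof. by move/(torsion_linear f); rewrite raddfB. Qed.

(* [Y / torsion] is injective, and the extensions lift to [Y]. *)
Definition injective_mod_torsion (Y : lmodType S^c) :=
  forall (M N : lmodType S^c) (f : {linear M -> N}) (g : {linear M -> Y}),
    (forall x, f x = 0 -> torsion (g x)) ->
    exists h : {linear N -> Y}, forall x, torsion (h (f x) - g x).

(* [X] is an augmented resolution, with [X 0] the resolved module. *)
Definition acyclic (X : nat -> lmodType S^c)
    (d : forall i, {linear X i -> X i.+1}) :=
  (forall x, d 0%N x = 0 -> x = 0) /\
  forall i x, d i.+1 x = 0 <-> exists y, x = d i y.

Section Lift.
Variables (X Y : nat -> lmodType S^c).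
Variables (dX : forall i, {linear X i -> X i.+1}).
Variables (dY : forall i, {linear Y i -> Y i.+1}).
Arguments dX {i}.
Arguments dY {i}.
Hypothesis exX : acyclic (@dX).
Hypothesis exY : acyclic (@dY).
Hypothesis injY : forall i, injective_mod_torsion (Y i.+1).

Definition chain_map_mod_torsion (f : forall i, {linear X i -> Y i}) :=
  forall i x, torsion (f i.+1 (dX x) - dY (f i x)).

Lemma acyclic_dd (Z : nat -> lmodType S^c) (d : forall i, {linear Z i -> Z i.+1}) :
  acyclic d -> forall i x, d i.+1 (d i x) = 0.
Proof. by move=> [_ ex] i x; apply/ex; exists x. Qed.

(** The comparison theorem for resolutions, read modulo torsion. Each recursive state also records
    that cycles go to cycles modulo torsion, which is what allows the next extension. *)
Lemma lift_mod_torsion (u : {linear X 0 -> Y 0}) :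
  exists f : forall i, {linear X i -> Y i}, f 0%N =1 u /\ chain_map_mod_torsion f.
Proof.
pose state i := {f : {linear X i -> Y i} | forall x, dX x = 0 -> torsion (dY (f x))}.
have next i (s : state i) : exists s' : state i.+1,
    forall x, torsion (sval s' (dX x) - dY (sval s x)).
  pose g : {linear X i -> Y i.+1} := dY \o sval s.
  have [h hE] := injY (proj2_sig s : forall x, dX x = 0 -> torsion (g x)).
  suff hP x : dX x = 0 -> torsion (dY (h x)) by exists (exist _ h hP).
  move=> /(exX.2 i) [x' ->].
  by have := torsion_linear dY (hE x'); rewrite raddfB /= (acyclic_dd exY) subr0.
have st0 x : dX x = 0 -> torsion (dY (u x)).
  by move/exX.1 => ->; rewrite !raddf0; exact: (submodule0 (torsB _)).
pose st := fix st i : state i :=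
  match i with 0%N => exist _ u st0 | j.+1 => projT1 (cid (next j (st j))) end.
exists (fun i => sval (st i)); split=> // i x.
exact: (projT2 (cid (next i (st i))) x).
Qed.

(** The usual construction, one degree at a time: [f i.+1] minus [dY] after [h i] sends cycles to
    torsion, so modulo torsion it factors through [dX]. It starts with zero because [f 0]
    vanishes. *)
Lemma homotopy_mod_torsion (f : forall i, {linear X i -> Y i}) :
  f 0%N =1 (fun=> 0) -> chain_map_mod_torsion f ->
  exists h : forall i, {linear X i.+1 -> Y i},
    forall i x, torsion (f i.+1 x - dY (h i x) - h i.+1 (dX x)).
Proof.
move=> f0 fC.
pose g i (h : {linear X i.+1 -> Y i}) : {linear X i.+1 -> Y i.+1} :=
  f i.+1 \- (dY \o h).
pose state i := {h : {linear X i.+1 -> Y i} |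
  forall x, dX x = 0 -> torsion (g i h x)}.
have next i (s : state i) : exists s' : state i.+1,
    forall x, torsion (sval s' (dX x) - g i (sval s) x).
  have [h hE] := injY (proj2_sig s).
  suff hP x : dX x = 0 -> torsion (g i.+1 h x) by exists (exist _ h hP).
  move=> /(exX.2 i.+1) [x' ->] /=.
  apply: (torsion_trans (fC i.+1 x')); apply: torsion_sym.
  have := torsion_linear dY (hE x').
  by rewrite /g raddfB /= raddfB /= [dY (dY _)](acyclic_dd exY) subr0.
have st0 x : dX x = 0 -> torsion (g 0%N \0 x).
  move=> /(exX.2 0%N) [x' ->]; rewrite /g /= raddf0 subr0.
  by have := fC 0%N x'; rewrite f0 raddf0 subr0.
pose st := fix st i : state i :=
  match i with
  | 0%N => exist _ (\0 : {linear X 1 -> Y 0}) st0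
  | j.+1 => projT1 (cid (next j (st j)))
  end.
exists (fun i => sval (st i)) => i x.
have := submoduleN (torsB _) (projT2 (cid (next i (st i))) x).
by rewrite opprB.
Qed.
End Lift.

(** Exactness at [X i.+1] of the quotient of [X] by its torsion. *)
Definition exact_mod_torsion (X : nat -> lmodType S^c)
    (d : forall i, {linear X i -> X i.+1}) i :=
  forall z, torsion (d i.+1 z) -> exists z', torsion (z - d i z').

(** The connecting map of $0 \to \Gamma X \to X \to X/\Gamma X \to 0$ with [X] acyclic: the quotient
    at [X i.+1] corresponds to the torsion complex at [X i.+2]. *)
Lemma exact_mod_torsionP (X : nat -> lmodType S^c)
    (d : forall i, {linear X i -> X i.+1}) i : acyclic d ->
  exact_mod_torsion d i <->
  (forall x, torsion x -> d i.+2 x = 0 -> exists2 y, torsion y & x = d i.+1 y).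
Proof.
move=> ex; split=> [H x Tx /(ex.2 i.+1) [z xz]|H z Tz].
  rewrite xz in Tx *; have [z' Tz'] := H _ Tx.
  by exists (z - d i z') => //; rewrite raddfB /= (acyclic_dd ex) subr0.
have [y Ty e] := H _ Tz (acyclic_dd ex z).
have /(ex.2 i) [z' zz'] : d i.+1 (z - y) = 0 by rewrite raddfB /= e subrr.
by exists z'; rewrite -zz' opprB addrC subrK.
Qed.

(** Lift [u] and [v] to [f] and [g]. The difference of the identity and [g f] is zero in degree 0,
    hence null-homotopic modulo torsion. *)
Lemma exact_mod_torsion_retract (X Y : nat -> lmodType S^c)
    (dX : forall i, {linear X i -> X i.+1}) (dY : forall i, {linear Y i -> Y i.+1})
    (u : {linear X 0 -> Y 0}) (v : {linear Y 0 -> X 0}) (i : nat) :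
  acyclic dX -> acyclic dY ->
  (forall i, injective_mod_torsion (X i.+1)) ->
  (forall i, injective_mod_torsion (Y i.+1)) ->
  cancel u v -> exact_mod_torsion dY i -> exact_mod_torsion dX i.
Proof.
move=> exX exY injX injY uv H z Tz.
have [f [f0 fC]] := lift_mod_torsion exX exY injY u.
have [g [g0 gC]] := lift_mod_torsion exY exX injX v.
pose c i : {linear X i -> X i} := idfun \- (g i \o f i).
have c0 : c 0%N =1 (fun=> 0) by move=> x; rewrite /c /= g0 f0 uv subrr.
have cC : chain_map_mod_torsion dX dX c.
  move=> j x; rewrite /c /= raddfB /= opprD opprK addrACA subrr add0r addrC.
  apply: torsion_sym; apply: torsion_trans (gC j (f j x)).
  exact: torsion_map (fC j x).
have [h hE] := homotopy_mod_torsion exX exX injX c0 cC.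
have [w Tw] : exists w, torsion (f i.+1 z - dY i w).
  apply: H.
  have := submoduleB (torsB _) (torsion_linear (f i.+2) Tz) (fC i.+1 z).
  by rewrite opprB addrC subrK.
(* Modulo torsion, [z] is [g (f z) + d (h z) + h (d z)], where [d z] is torsion and [f z] is
   [d w]. *)
exists (g i w + h i z).
have t1 := torsion_trans (torsion_map (g i.+1) Tw) (gC i w).
have t2 := submoduleD (torsB _) (hE i z) (torsion_linear (h i.+1) Tz).
have := submoduleD (torsB _) t2 t1.
by rewrite subrK /c /= addrACA subrK -opprD -raddfD [h i z + _]addrC.
Qed.
End Comparison.

(** * Invariants and the radical *)

Lemma acc_maximal (T : Type) (P F : set T -> Prop) (I0 : set T) :
  acc P -> (forall I, F I -> P I) -> F I0 ->
  exists I, F I /\ forall J, F J -> I `<=` J -> J `<=` I.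
Proof.
move=> accP FP F0; apply: contrapT => nmax.
have next (I : {I | F I}) : exists J : {I | F I},
    sval I `<=` sval J /\ ~ sval J `<=` sval I.
  apply: contrapT => nJ; apply: nmax; exists (sval I).
  split; first exact: (proj2_sig I).
  by move=> J FJ IJ; apply: contrapT => JI; apply: nJ; exists (exist _ J FJ).
have [f fE] := choice next.
pose s n : {I | F I} := iter n f (exist _ I0 F0).
have [|n|N hN] := accP (fun n => sval (s n)).
- by move=> n; apply: FP; exact: (proj2_sig (s n)).
- by have [] := fE (s n).
- by have [_] := fE (s N); apply; rewrite -[X in _ `<=` X](hN N.+1).
Qed.

Section Invariants.
Variables (G : finGroupType) (k : fieldType) (R : algType k).
Variable act : module_algebra G R.
Local Notation A := (invariants act).

Lemma act_val g (c : A) : act g (val c) = val c.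
Proof. by have /forallP /(_ g) /eqP := inv_valP c. Qed.

Lemma trace_fixed (x : R) : \sum_g act g x \in fixed_by act.
Proof.
apply/forallP => h; apply/eqP; rewrite raddf_sum /=.
rewrite [RHS](reindex_inj (mulgI h)) /=.
by apply: eq_bigr => g _; rewrite mactM.
Qed.

Definition trace (x : R) : A := Invariants (trace_fixed x).

Lemma trace_val x : val (trace x) = \sum_g act g x. Proof. by []. Qed.

Lemma traceD x y : trace (x + y) = trace x + trace y.
Proof.
apply: val_inj; rewrite rmorphD /= -big_split; apply: eq_bigr => g _.
by rewrite raddfD.
Qed.

Lemma trace0 : trace 0 = 0.
Proof. by apply: val_inj; rewrite raddf0 /= big1 // => g _; rewrite raddf0. Qed.

Lemma traceMl (c : A) x : trace (val c * x) = c * trace x.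
Proof.
apply: val_inj; rewrite rmorphM /= mulr_sumr; apply: eq_bigr => g _.
by rewrite rmorphM /= act_val.
Qed.

Lemma traceMr (c : A) x : trace (x * val c) = trace x * c.
Proof.
apply: val_inj; rewrite rmorphM /= mulr_suml; apply: eq_bigr => g _.
by rewrite rmorphM /= act_val.
Qed.

Lemma trace_const (c : A) : trace (val c) = c *+ #|G|.
Proof.
apply: val_inj; rewrite raddfMn /=; under eq_bigr do rewrite act_val.
by rewrite sumr_const.
Qed.

(** After exchanging the sums over [i] and [g], pertinence leaves only the term [g = 1]. Hence right
    multiples of the radical element lie in the right span of the [a i] over the invariants. *)
Lemma pertinent_mull n (a b : 'I_n -> R) v : pertinent act a b ->
  (\sum_i a i * b i) * v = \sum_i a i * val (trace (b i * v)).
Proof.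
move=> hp; under [RHS]eq_bigr do rewrite trace_val mulr_sumr.
rewrite exchange_big (bigD1 1%g) //= [X in _ + X]big1 ?addr0.
  by rewrite mulr_suml; apply: eq_bigr => i _; rewrite mact1 mulrA.
move=> g g1; under eq_bigr do rewrite rmorphM mulrA.
by rewrite -mulr_suml hp // mul0r.
Qed.

Lemma pertinent_mulr n (a b : 'I_n -> R) v : pertinent act a b ->
  v * (\sum_i a i * b i) = \sum_i val (trace (v * a i)) * b i.
Proof.
move=> hp; under [RHS]eq_bigr do rewrite trace_val mulr_suml.
rewrite exchange_big (bigD1 1%g) //= [X in _ + X]big1 ?addr0.
  by rewrite mulr_sumr; apply: eq_bigr => i _; rewrite mact1 mulrA.
move=> g g1; under eq_bigr do rewrite rmorphM -mulrA.
rewrite -mulr_sumr; apply/eqP; rewrite (_ : \sum_i _ = 0) ?mulr0 //.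
(* The vanishing needed here has [g] on the first sequence; it is the image under [g] of pertinence
   at the inverse of [g]. *)
have /(congr1 (act g)) : \sum_i a i * act g^-1%g (b i) = 0.
  by apply: hp; apply: contra g1 => /eqP /(congr1 invg); rewrite invgK invg1 => ->.
rewrite raddf0 raddf_sum /= => e; rewrite -[RHS]e; apply: eq_bigr => i _.
by rewrite rmorphM /= -mactM mulgV mact1.
Qed.

(** Sums come from concatenating pertinent sequences, and left multiples from multiplying the first
    sequence. *)
Lemma radical_left_ideal : left_ideal (radical act).
Proof.
split.
- exists 1%N, (fun=> 0), (fun=> 0); split=> //; last by rewrite big_ord1 mul0r.
  by move=> g _; rewrite big_ord1 mul0r.
- move=> _ _ [n [a [b [n0 ab ->]]]] [m [c [d [m0 cd ->]]]].
  pose f (f1 : 'I_n -> R) (f2 : 'I_m -> R) (i : 'I_(n + m)) :=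
    match fintype.split i with inl j => f1 j | inr j => f2 j end.
  have fl f1 f2 j : f f1 f2 (lshift m j) = f1 j by rewrite /f (unsplitK (inl j)).
  have fr f1 f2 j : f f1 f2 (rshift n j) = f2 j by rewrite /f (unsplitK (inr j)).
  exists (n + m)%N, (f a c), (f b d); split; first by rewrite addn_gt0 n0.
    move=> g g1; rewrite big_split_ord /=.
    under eq_bigr do rewrite !fl. under [X in _ + X]eq_bigr do rewrite !fr.
    by rewrite ab // cd // addr0.
  by rewrite big_split_ord /=; congr (_ + _); apply: eq_bigr => i _; rewrite ?fl ?fr.
- move=> x _ [n [a [b [n0 ab ->]]]]; exists n, (fun i => x * a i), b; split=> //.
    by move=> g g1; under eq_bigr do rewrite -mulrA; rewrite -mulr_sumr ab // mulr0.
  by rewrite mulr_sumr; apply: eq_bigr => i _; rewrite mulrA.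
Qed.

Lemma radical_right_ideal : right_ideal (radical act).
Proof.
have [r0 rD _] := radical_left_ideal; split=> //.
move=> x _ [n [a [b [n0 ab ->]]]]; exists n, a, (fun i => b i * x); split=> //.
  move=> g g1; under eq_bigr do rewrite rmorphM mulrA.
  by rewrite -mulr_suml ab // mul0r.
by rewrite mulr_suml; apply: eq_bigr => i _; rewrite mulrA.
Qed.

Lemma inv_radical_left_ideal : left_ideal (inv_radical act).
Proof.
have [r0 rD rM] := radical_left_ideal; split; rewrite /inv_radical.
- exact: r0.
- by move=> x y; exact: rD.
- by move=> x y; exact: rM.
Qed.

Lemma inv_radical_right_ideal : right_ideal (inv_radical act).
Proof.
have [r0 rD rM] := radical_right_ideal; split; rewrite /inv_radical.
- exact: r0.
- by move=> x y; exact: rD.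
- by move=> x y; exact: rM.
Qed.

Lemma inv_radical_pow n (x : A) :
  set_pow (inv_radical act) n x -> set_pow (radical act) n (val x).
Proof.
elim: n x => [|n IHn] //=; apply: set_mul_sub => [|x y|x y Ix Jy] /=.
- exact: set_mul0.
- exact: set_mulD.
- by apply: set_mulM => //; exact: IHn.
Qed.

Section Reynolds.
Hypothesis char_G : forall p : nat, p \in [pchar k]%R -> ~~ (p %| #|G|)%N.

Lemma card_neq0 : (#|G|%:R : k) != 0.
Proof.
rewrite natf_neq0_pchar; apply/pnatP; first by apply/card_gt0P; exists 1%g.
by move=> p _ pG; apply/negP => /char_G; rewrite pG.
Qed.

Definition reynolds (x : R) : A := (#|G|%:R : k)^-1 *: trace x.

Lemma reynolds_val (c : A) : reynolds (val c) = c.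
Proof.
rewrite /reynolds trace_const -scaler_nat scalerA mulVf ?scale1r //.
exact: card_neq0.
Qed.

Lemma reynoldsD x y : reynolds (x + y) = reynolds x + reynolds y.
Proof. by rewrite /reynolds traceD scalerDr. Qed.

Lemma reynoldsMl (c : A) x : reynolds (val c * x) = c * reynolds x.
Proof. by rewrite /reynolds traceMl scalerAr. Qed.

Lemma reynoldsMr (c : A) x : reynolds (x * val c) = reynolds x * c.
Proof. by rewrite /reynolds traceMr scalerAl. Qed.

(** A right ideal [C] of the invariants is recovered from its extension $CR$, since the Reynolds
    operator maps $CR$ into [C] and fixes [C]. *)
Lemma invariants_noetherian : acc (@right_ideal R) -> acc (@right_ideal A).
Proof.
move=> accR C CR Cinc.
pose D n := set_mul (val @` C n) [set: R].
have [||N hN] := accR D.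
- by move=> n; exact: set_mul_right_ideal.
- by move=> n; apply: set_mulS => // _ [c Cc <-]; exists c => //; exact: Cinc.
have DC n : D n `<=` [set x | C n (reynolds x)].
  have [C0 CD CM] := CR n.
  apply: set_mul_sub => [|x y|_ y [c Cc <-] _] /=.
  - by rewrite -(raddf0 (val : A -> R)) reynolds_val.
  - by rewrite reynoldsD; exact: CD.
  - by rewrite reynoldsMl; exact: CM.
have CDn n c : C n c -> D n (val c).
  by move=> Cc; rewrite -[val c]mulr1; apply: set_mulM => //; exists c.
exists N => n Nn; apply/seteqP; split=> c Cc.
  by have := CDn _ _ Cc; rewrite hN // => /DC /=; rewrite reynolds_val.
by have := CDn _ _ Cc; rewrite -(hN n) // => /DC /=; rewrite reynolds_val.
Qed.
End Reynolds.
End Invariants.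

(** * The Artin-Rees property of the radical *)

(** Induction on [s]: the property for the right ideal $C I^s$ gives one more factor $I$. *)
Lemma artin_rees_powers (S : pzRingType) (I : set S) :
  left_ideal I -> right_ideal I -> right_artin_rees I ->
  artin_rees_filtration (set_pow I).
Proof.
move=> IL IR AR; split.
- by move=> n; exact: set_pow_left_ideal.
- by move=> n; exact: set_pow_right_ideal.
- by move=> n; exact: set_powSW.
- move=> C CR; elim=> [|s [n hn]].
    by exists 0%N => c [Cc _]; rewrite -[c]mulr1; exact: set_mulM.
  have [m hm] := AR _ (set_mul_right_ideal C (set_pow_right_ideal s IR)).
  exists (maxn n m) => c [Cc Ic]; apply/set_mulA/hm; split.
    by apply: hn; split=> //; apply: set_pow_leq Ic => //; exact: leq_maxl.
  by apply: set_pow_leq Ic => //; exact: leq_maxr.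
Qed.

Section ArtinRees.
Variables (G : finGroupType) (k : fieldType) (R : algType k).
Variable act : module_algebra G R.
Local Notation A := (invariants act).
Local Notation a := (inv_radical act).
Local Notation r := (radical act).

Lemma inv_val0 : inv_val (0 : A) = 0. Proof. by []. Qed.
Lemma inv_val1 : inv_val (1 : A) = 1. Proof. by []. Qed.
Lemma inv_valD (c d : A) : inv_val (c + d) = inv_val c + inv_val d.
Proof. by []. Qed.
Lemma inv_valN (c : A) : inv_val (- c) = - inv_val c. Proof. by []. Qed.
Lemma inv_valM (c d : A) : inv_val (c * d) = inv_val c * inv_val d.
Proof. by []. Qed.

(* [\sum_j y_j B] *)
Fixpoint inv_span (y : seq R) (B : set A) : set R :=
  if y is y0 :: y' then
    [set x | exists2 c, B c & inv_span y' B (x - y0 * inv_val c)]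
  else [set 0].

Section Span.
Variables (y : seq R) (B : set A).
Hypotheses (B0 : B 0) (BD : forall c d, B c -> B d -> B (c + d)).

Lemma inv_span0 : inv_span y B 0.
Proof.
elim: y => [|y0 y' IHy] //=; exists 0 => //.
by rewrite inv_val0 mulr0 subr0.
Qed.

Lemma inv_spanD x z : inv_span y B x -> inv_span y B z -> inv_span y B (x + z).
Proof.
elim: y x z => [|y0 y' IHy] x z /=; first by move=> -> ->; rewrite addr0.
move=> [c Bc hx] [d Bd hz]; exists (c + d); first exact: BD.
by rewrite inv_valD mulrDr opprD addrACA; exact: IHy.
Qed.

Lemma inv_spanM (B' : set A) c x : (forall d, B d -> B' (d * c)) ->
  inv_span y B x -> inv_span y B' (x * inv_val c).
Proof.
move=> BB; elim: y x => [|y0 y' IHy] x /=; first by move=> ->; rewrite mul0r.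
move=> [d Bd hx]; exists (d * c); first exact: BB.
by rewrite inv_valM mulrA -mulrBl; exact: IHy.
Qed.

Lemma inv_spanN x : (forall c, B c -> B (- c)) -> inv_span y B x -> inv_span y B (- x).
Proof.
move=> BN; elim: y x => [|y0 y' IHy] x /=; first by move=> ->; rewrite oppr0.
move=> [c Bc hx]; exists (- c); first exact: BN.
by rewrite inv_valN mulrN -opprD; exact: IHy.
Qed.

Lemma inv_spanS (B' : set A) : B `<=` B' -> inv_span y B `<=` inv_span y B'.
Proof.
move=> BB; elim: y => [|y0 y' IHy] x //= [c Bc hx].
by exists c; [exact: BB|exact: IHy].
Qed.
End Span.

Lemma inv_span_sum (I : Type) (s : seq I) (f : I -> R) (c : I -> A) y x :
  inv_span y setT x ->
  inv_span ([seq f i | i <- s] ++ y) setT (\sum_(i <- s) f i * val (c i) + x).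
Proof.
move=> hx; elim: s => [|i s IHs] /=; first by rewrite big_nil add0r.
by exists (c i) => //; rewrite big_cons addrC addrA addKr.
Qed.

Lemma inv_radical_pow_ideal n :
  left_ideal (set_pow a n) /\ right_ideal (set_pow a n).
Proof.
by split; [exact/set_pow_left_ideal/inv_radical_left_ideal
          |exact/set_pow_right_ideal/inv_radical_right_ideal].
Qed.

Lemma inv_radical_pow0 n : set_pow a n 0.
Proof. by have [[]] := inv_radical_pow_ideal n. Qed.
Lemma inv_radical_powD n c d : set_pow a n c -> set_pow a n d -> set_pow a n (c + d).
Proof. by have [[_ + _] _] := inv_radical_pow_ideal n; apply. Qed.
Lemma inv_radical_powMl n c d : set_pow a n c -> set_pow a n (d * c).
Proof. by have [[_ _ +] _] := inv_radical_pow_ideal n; apply. Qed.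
Lemma inv_radical_powN n c : set_pow a n c -> set_pow a n (- c).
Proof. by rewrite -mulN1r; exact: inv_radical_powMl. Qed.
Lemma inv_radical_pow_leq m n : (m <= n)%N -> set_pow a n `<=` set_pow a m.
Proof. by apply: set_pow_leq; exact: inv_radical_right_ideal. Qed.

Local Notation vpow n := (@inv_val _ _ _ act @` set_pow a n).

Hypothesis AR : right_artin_rees a.

(** The module form of Artin-Rees, for an $A$-submodule [N] of $R$, by induction on the generators:
    the property for the right ideal of coefficients of [y0] removes the [y0]-term by an element of
    $N\mathfrak a^m$. *)
Lemma inv_span_artin_rees (N : set R) : N 0 ->
  (forall x z, N x -> N z -> N (x + z)) ->
  (forall x (c : A), N x -> N (x * inv_val c)) ->
  forall y s, exists n, N `&` inv_span y (set_pow a n) `<=` set_mul N (vpow s).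
Proof.
move=> N0 ND NM; have NN x : N x -> N (- x).
  move=> Nx; have := NM x (-1) Nx; rewrite inv_valN inv_val1.
  by rewrite mulrN1.
elim=> [|y0 y IHy] s.
  by exists 0%N => x [_ /= ->]; exact: set_mul0.
(* At least [n1], so that the remainder falls under the induction hypothesis, and at least [s], so
   that $N\mathfrak a^m \subseteq N\mathfrak a^s$. *)
have [n1 hn1] := IHy s; pose m := maxn n1 s.
pose C : set A := [set c | exists2 u, inv_span y setT u & N (u + y0 * inv_val c)].
have CR : right_ideal C.
  split.
  - exists 0; first exact: inv_span0.
    by rewrite inv_val0 mulr0 addr0.
  - move=> c d [u hu Nu] [v hv Nv]; exists (u + v); first exact: inv_spanD.
    by rewrite inv_valD mulrDr addrACA; exact: ND.
  - move=> d c [u hu Nu]; exists (u * inv_val d); first exact: inv_spanM hu.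
    by rewrite inv_valM mulrA -mulrDl; exact: NM.
have [_ _ _ /(_ C CR m) [n2 hn2]] :=
  artin_rees_powers (@inv_radical_left_ideal _ _ _ act)
    (@inv_radical_right_ideal _ _ _ act) AR.
(* For such a coefficient [c], some [v] in $N\mathfrak a^m$ agrees with [y0 c] up to the span of the
   other generators over $\mathfrak a^m$. *)
have approx : set_mul C (set_pow a m) `<=` [set c | exists v,
    [/\ N v, set_mul N (vpow m) v & inv_span y (set_pow a m) (y0 * inv_val c - v)]].
  apply: set_mul_sub => [|c d|c d [u hu Nu] Id] /=.
  - exists 0; split=> //; first exact: set_mul0.
    by rewrite ?inv_val0 mulr0 subr0; apply: inv_span0; exact: inv_radical_pow0.
  - move=> [v [Nv Nv' hv]] [w [Nw Nw' hw]]; exists (v + w).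
    split; [exact: ND|exact: set_mulD|].
    rewrite ?inv_valD mulrDr opprD addrACA; apply: inv_spanD => //.
    exact: inv_radical_powD.
  - exists ((u + y0 * inv_val c) * inv_val d); split; first exact: NM.
      by apply: set_mulM => //; exists d.
    rewrite ?inv_valM mulrDl mulrA opprD addrC subrK.
    apply: inv_spanN => [e|]; first exact: inv_radical_powN.
    by apply: inv_spanM hu => e _; exact: inv_radical_powMl.
exists (maxn m n2) => x [Nx] /= [c Ic hx].
have Cc : C c.
  exists (x - y0 * inv_val c); last by rewrite subrK.
  by apply: inv_spanS hx => ?.
have [|v [Nv Nv' hv]] := approx c.
  by apply: hn2; split=> //; apply: inv_radical_pow_leq Ic; exact: leq_maxr.
have -> : x = (x - v) + v by rewrite subrK.
apply: set_mulD.
  apply: hn1; split; first by apply: ND => //; exact: NN.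
  rewrite -(subrK (y0 * inv_val c) x) -addrA; apply: inv_spanD.
  - exact: inv_radical_powD.
  - by apply: inv_spanS hx; apply: inv_radical_pow_leq; rewrite leq_max leq_max leqnn.
  - by apply: inv_spanS hv; apply: inv_radical_pow_leq; rewrite leq_max leqnn.
apply: set_mulS Nv' => // _ [d Id <-]; exists d => //.
by apply: inv_radical_pow_leq Id; exact: leq_maxr.
Qed.

Hypothesis noethR : acc (@right_ideal R).

(** Take a maximal right ideal [I] among those inside the radical and inside a finitely generated
    $A$-span. For [x] in the radical, [pertinent_mull] puts $xR$ in such a span, so $I + xR$ is
    again in the family and [x] lies in [I]. *)
Lemma radical_inv_span : exists y, r `<=` inv_span y setT.
Proof.
pose F (I : set R) := [/\ right_ideal I, I `<=` r & exists y, I `<=` inv_span y setT].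
have [r0 rD rM] := radical_right_ideal act.
have [||I [[[I0 ID IM] Ir [y Iy]] maxI]] := acc_maximal (F := F) (I0 := [set 0]) noethR.
- by move=> I [].
- split; last by exists [::].
    split=> //= [x z -> ->|z x ->]; first by rewrite addr0.
    by rewrite mul0r.
  by move=> x ->.
exists y => x rx; apply: (Iy).
pose J : set R := [set z | exists2 w, I w & exists v, z = x * v + w].
apply: (maxI J).
- split.
  + split.
    * by exists 0 => //; exists 0; rewrite mulr0 addr0.
    * move=> _ _ [w Iw [v ->]] [w' Iw' [v' ->]]; exists (w + w'); first exact: ID.
      by exists (v + v'); rewrite mulrDr addrACA.
    * move=> z _ [w Iw [v ->]]; exists (w * z); first exact: IM.
      by exists (v * z); rewrite mulrDl mulrA.
  + by move=> _ [w Iw [v ->]]; apply: rD; [exact: rM|exact: Ir].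
  + have [n [b [c [_ bc xE]]]] := rx.
    exists ([seq b i | i <- index_enum 'I_n] ++ y) => _ [w Iw [v ->]].
    by rewrite xE (pertinent_mull v bc); apply: inv_span_sum; exact: Iy.
- by move=> w Iw; exists w => //; exists 0; rewrite mulr0 add0r.
- by exists 0 => //; exists 1; rewrite mulr1 addr0.
Qed.

Hypothesis cof : cofinal a r.

(** Induction on [n] from $\mathfrak aR = R\mathfrak a$, moving one factor at a time. *)
Lemma inv_radical_pow_commute n : set_mul (vpow n) setT `<=` set_mul setT (vpow n).
Proof.
elim: n => [|n IHn].
  apply: set_mul_sub => [|x z|x z _ _]; [exact: set_mul0|exact: set_mulD|].
  rewrite -[x * z]mulr1; apply: set_mulM => //; exists 1 => //; exact: inv_val1.
apply: set_mul_sub => [|x z|_ z [c Ic <-] _]; [exact: set_mul0|exact: set_mulD|].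
suff : set_mul (set_pow a n) a `<=` [set c | set_mul setT (vpow n.+1) (inv_val c * z)].
  by apply.
apply: set_mul_sub => [|d e|d e Id Ie] /=.
- by rewrite mul0r; exact: set_mul0.
- by rewrite mulrDl; exact: set_mulD.
rewrite -mulrA.
have : set_mul setT (@inv_val _ _ _ act @` a) (inv_val e * z).
  by rewrite -cof.1; apply: set_mulM => //; exists e.
move: (inv_val e * z); apply: set_mul_sub => [|u v|u _ _ [f If <-]].
- by rewrite mulr0; exact: set_mul0.
- by rewrite mulrDr; exact: set_mulD.
rewrite mulrA.
have : set_mul setT (vpow n) (inv_val d * u).
  by apply: IHn; apply: set_mulM => //; exists d.
move: (inv_val d * u); apply: set_mul_sub => [|v w|v _ _ [g Ig <-]].
- by rewrite mul0r; exact: set_mul0.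
- by rewrite mulrDl; exact: set_mulD.
rewrite -mulrA; apply: set_mulM => //; exists (g * f) => //; exact: set_mulM.
Qed.

Lemma radical_artin_rees : artin_rees_filtration (set_pow r).
Proof.
have rL := radical_left_ideal act; have rR := radical_right_ideal act; split.
- by move=> n; exact: set_pow_left_ideal.
- by move=> n; exact: set_pow_right_ideal.
- by move=> n; exact: set_powSW.
- move=> C [C0 CD CM] s.
  have [y ry] := radical_inv_span.
  have [n hn] := inv_span_artin_rees C0 CD (fun x c Cx => CM (inv_val c) x Cx) y s.
  have [m hm] := cof.2 n.
  (* $\mathfrak r^{1+m} \subseteq \mathfrak r\,\mathfrak a^nR \subseteq \mathfrak r R\,\mathfrak a^n
     \subseteq \sum_j y_j\mathfrak a^n$; the extra factor $\mathfrak r$ is what enters the finite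
     span. *)
  exists (1 + m)%N => x [Cx /set_pow_add rx].
  suff : inv_span y (set_pow a n) x.
    move=> yx; have := hn x (conj Cx yx); apply: set_mulS => // _ [c Ic <-].
    exact: inv_radical_pow.
  move: x rx {Cx}; apply: set_mul_sub => [|u v|u v ru rv].
  + by apply: inv_span0; exact: inv_radical_pow0.
  + by apply: inv_spanD; exact: inv_radical_powD.
  have {}ru := set_pow1 rL ru.
  move: v rv => v /hm /inv_radical_pow_commute; move: v.
  apply: set_mul_sub => [|v w|v _ _ [c Ic <-]].
  + by rewrite mulr0; apply: inv_span0; exact: inv_radical_pow0.
  + by rewrite mulrDr; apply: inv_spanD; exact: inv_radical_powD.
  rewrite mulrA; apply: (inv_spanM (B := setT)).
    by move=> d _; exact: inv_radical_powMl.
  by apply: ry; have [_ _] := rR; apply.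
Qed.
End ArtinRees.

(** * Injective modules restricted to the invariants *)

(** Composing [g] with the projection that kills torsion changes it only by torsion and makes it
    vanish on the kernel of [f]. *)
Lemma injective_injective_mod_torsion (S : pzRingType) (B : nat -> set S)
    (E : lmodType S^c) :
  acc (@right_ideal S) -> artin_rees_filtration B -> injective_module E ->
  injective_mod_torsion B E.
Proof.
move=> noethS AR injE; have [p [p0 pp]] := torsion_projection noethS AR injE.
move=> M N f g fg.
have [|h hE] := injective_factor (f := f) (g := p \o g) injE.
  by move=> x /fg /p0.
by exists h => x; rewrite hE; apply/p0; rewrite raddfB /= pp subrr.
Qed.

Section RestrictedInjective.
Variables (G : finGroupType) (k : fieldType) (R : algType k).
Variable act : module_algebra G R.
Local Notation A := (invariants act).
Local Notation a := (inv_radical act).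
Local Notation r := (radical act).

Definition inv_incl : {rmorphism A -> R} := val.

Hypothesis cof : cofinal a r.

(** Both kinds of torsion agree because $\mathfrak a^n \subseteq \mathfrak r^n$ and $\mathfrak r^m
    \subseteq \mathfrak a^nR$ for some [m]. *)
Lemma restriction_torsion (J : lmodType R^c) (x : J) :
  @torsion A (set_pow a) (restriction inv_incl J) x <-> torsion (set_pow r) x.
Proof.
split=> [[n hn]|[n hn]]; last by exists n => c /inv_radical_pow /hn.
have [m hm] := cof.2 n; exists m => b /hm; move: b.
apply: set_mul_sub => [|b c hb hc|_ b [c /hn hc <-] _].
- exact: scale0r.
- by rewrite [_ *: _]scalerDl hb hc addr0.
- have -> : ((val c * b : R) : R^c) *: x = (b : R^c) *: ((val c : R^c) *: x).
    by rewrite scalerA.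
  by rewrite [_ *: x]hc scaler0.
Qed.

Hypothesis noethR : acc (@right_ideal R).
Hypothesis AR : right_artin_rees a.

Section Injective.
Variables (J : lmodType R^c) (p : {linear J -> J}).
Hypothesis injJ : injective_module J.
Hypothesis p0 : forall x, p x = 0 <-> torsion (set_pow r) x.
Hypothesis pp : forall x, p (p x) = p x.

Lemma fixed_submodule :
  @submodule A^c (restriction inv_incl J) [set x | p x = x].
Proof.
split; first exact: raddf0.
by move=> c x y /= px py; rewrite restrictionZ linearP /= px py.
Qed.

(* Given a partial [A]-linear map [H] from [A] to [p J], the pairs [(z, w)] with
   [p w = w] and [w x = \sum_i H (tr (z b_i)) c_i] whenever [x = \sum_i b_i c_i]
   with [b], [c] pertinent form a partial [R]-linear map, as [z] determines [w]
   up to torsion. It extends [H] since [x = \sum_i tr(b_i) c_i]. *)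
Lemma torsion_free_part_injective : injective_module (submodule_type fixed_submodule).
Proof.
apply: graph_injective; apply: baer => H hH H0.
pose J' := submodule_type fixed_submodule.
pose K : set (R^c^o * J) := [set z | p z.2 = z.2 /\
  forall n (b c : 'I_n -> R), pertinent act b c -> exists e : 'I_n -> J',
    (forall i, H (trace act ((z.1 : R) * b i), e i)) /\
    ((\sum_i b i * c i : R) : R^c) *: z.2 = \sum_i (c i : R^c) *: (val (e i) : J)].
have hK : submodule K.
  split.
    split; first exact: raddf0.
    move=> n b c bc; exists (fun=> 0); split=> [i|] /=.
      by rewrite mul0r trace0; exact: (submodule0 hH).
    by rewrite scaler0 big1 // => i _; exact: scaler0.
  move=> s [z w] [z' w'] [/= pw hw] [/= pw' hw'].
  split; first by rewrite /= linearP /= pw pw'.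
  move=> n b c bc /=.
  (* Scaling [z] by [s] on the right is absorbed into the first sequence, which stays pertinent. *)
  have sbc : pertinent act (fun i => (s : R) * b i) c.
    move=> g g1; under eq_bigr do rewrite -mulrA.
    by rewrite -mulr_sumr bc // mulr0.
  have [e [he e1]] := hw _ _ _ sbc; have [e' [he' e1']] := hw' _ _ _ bc.
  exists (fun i => e i + e' i); split=> [i|].
    have -> : ((s *: z + z' : R^c^o) : R) * b i =
        (z : R) * ((s : R) * b i) + (z' : R) * b i.
      by rewrite mulrA -mulrDl.
    by rewrite traceD; exact: (submoduleD hH (he i) (he' i)).
  rewrite scalerDr e1' scalerA.
  have -> : (((\sum_i b i * c i : R) : R^c) * s : R^c) =
      \sum_i ((s : R) * b i) * c i :> R.
    by under [RHS]eq_bigr do rewrite -mulrA; rewrite -mulr_sumr.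
  by rewrite e1 -big_split; apply: eq_bigr => i _; exact/esym/scalerDr.
(* For [z = 0] every [e i] is zero, so [w] is killed by the radical; being torsion and fixed by [p],
   it vanishes. *)
have K0 w : K (0, w) -> w = 0.
  case=> /= pw hw; rewrite -pw; apply/p0; exists 1%N => x.
  move=> /(set_pow1 (radical_left_ideal act)) [n [b [c [_ bc ->]]]].
  have [e [he ->]] := hw _ _ _ bc; rewrite big1 // => i _.
  have -> : e i = 0 by apply: H0; have := he i; rewrite mul0r trace0.
  exact: scaler0.
have HK c y : H (c, y) -> K (val c, val y).
  move=> Hcy; split; first exact: (submodule_mem y).
  move=> n b d bd; exists (fun i => (trace act (b i) : A^c) *: y); split=> [i|] /=.
    by rewrite traceMl; exact: (submoduleZ hH (trace act (b i) : A^c) Hcy).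
  have := pertinent_mulr 1 bd; rewrite mul1r => ->.
  rewrite scaler_suml; apply: eq_bigr => i _.
  rewrite mul1r.
  by have -> : ((val (trace act (b i)) * d i : R) : R^c) *: (val y : J) =
      (d i : R^c) *: ((val (trace act (b i)) : R^c) *: (val y : J)) by rewrite scalerA.
have [h hE] := injective_graph injJ hK K0.
(* The value [h 1] may lie outside the image of [p]; its projection can replace it since [p] fixes
   the prescribed values. *)
have pe : p (p (h 1)) = p (h 1) by exact: pp.
pose e : J' := to_submodule fixed_submodule pe.
have [f fE] := scale_linear (e : J').
exists f => c y /HK hcy; rewrite fE; apply: val_inj.
have [/= <- _] := hcy; rewrite -(hE _ _ hcy) (regular_linearE h (val c : R^c)).
exact/esym/linearZ.
Qed.
End Injective.

Lemma restriction_injective_mod_torsion (J : lmodType R^c) : injective_module J ->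
  injective_mod_torsion (set_pow a) (restriction inv_incl J).
Proof.
move=> injJ M N f g fg.
have [p [p0 pp]] := torsion_projection noethR (radical_artin_rees AR noethR cof) injJ.
pose hp := fixed_submodule p.
have [q qE] : exists q : {linear restriction inv_incl J -> submodule_type hp},
    forall x, q x = to_submodule hp (pp x).
  apply: make_linear => c x y; apply: val_inj.
  rewrite (linearP (submodule_incl hp)) /= restrictionZ; exact: linearP.
have [|h hE] := injective_factor (f := f) (g := q \o g)
    (torsion_free_part_injective injJ p0 pp).
  move=> x /fg /restriction_torsion /p0 e /=; rewrite qE; apply: val_inj; exact: e.
exists (submodule_incl hp \o h) => x /=.
rewrite hE /= qE; apply/restriction_torsion/p0.
by rewrite raddfB /= pp subrr.
Qed.
End RestrictedInjective.

(** * Local cohomology *)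

Section LocalCohomology.
Variables (S : pzRingType) (s : set S) (M : lmodType S^c).
Hypothesis sR : right_ideal s.

Lemma local_cohomology_zero0 : local_cohomology_zero s M 0 ->
  forall (E : injective_resolution M) x,
    torsion (set_pow s) x -> idiff E 0 x = 0 -> x = 0.
Proof.
move=> H E x [n hn] dx; have [f fE] := scale_linear x.
have [|m _ /= f0] := H E n f.
  by split=> b; [move=> /hn; rewrite fE|rewrite fE linearZ /= dx scaler0].
by have := f0 1; rewrite fE scale1r.
Qed.

Lemma torsion_local_cohomology_zero0 :
  (forall (E : injective_resolution M) x,
    torsion (set_pow s) x -> idiff E 0 x = 0 -> x = 0) ->
  local_cohomology_zero s M 0.
Proof.
move=> H E n f [f0 df]; exists n => //= x.
rewrite (regular_linearE f (x : S^c)) (H E (f 1)) ?scaler0 //.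
by exists n => b /f0 <-; rewrite -regular_linearE.
Qed.

(** A linear map from $S$ is its value at 1, and killing some power of [s] makes this value torsion,
    so the colimit of the Hom complexes is the torsion subcomplex. *)
Lemma local_cohomology_zeroSP i : local_cohomology_zero s M i.+1 <->
  forall (E : injective_resolution M) x,
    torsion (set_pow s) x -> idiff E i.+1 x = 0 ->
    exists2 y, torsion (set_pow s) y & x = idiff E i y.
Proof.
split=> H E.
- move=> x [n hn] dx; have [f fE] := scale_linear x.
  have [|m _ /= [g g0 fg]] := H E n f.
    by split=> b; [move=> /hn; rewrite fE|rewrite fE linearZ /= dx scaler0].
  exists (g 1); last by rewrite -fg fE scale1r.
  by exists m => b /g0; rewrite regular_linearE.
- move=> n f [f0 df].
  have [|//|y [m hm] fy] := H E (f 1).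
    by exists n => b /f0; rewrite regular_linearE.
  have [g gE] := scale_linear y.
  exists (maxn n m); first exact: leq_maxl.
  exists g => x; last by rewrite (regular_linearE f (x : S^c)) fy gE linearZ.
  by move=> /(set_pow_leq sR (leq_maxr n m)) /hm; rewrite gE.
Qed.
End LocalCohomology.

Section Augmented.
Variables (S : pzRingType) (M : lmodType S^c) (E : injective_resolution M).

(** Degrees shift by one: [M] sits in degree 0 and [ires E j] in degree [j.+1]. *)
Definition augmented (i : nat) : lmodType S^c := if i is j.+1 then ires E j else M.

Definition augmented_diff (i : nat) : {linear augmented i -> augmented i.+1} :=
  match i with 0%N => iaug E | j.+1 => idiff E j end.

Lemma augmented_acyclic : acyclic augmented_diff.
Proof.
split=> [x|[|i] x] /=; [|exact: ires_exact0|exact: ires_exact].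
by move=> e; apply: (@iaug_inj _ _ E); rewrite e raddf0.
Qed.
End Augmented.

Lemma restriction_linear (S T : pzRingType) (u : {rmorphism S -> T})
    (M N : lmodType T^c) (f : {linear M -> N}) :
  exists h : {linear restriction u M -> restriction u N}, forall x, h x = f x.
Proof. by apply: make_linear => c x y; rewrite linearP. Qed.

Definition restriction_map (S T : pzRingType) (u : {rmorphism S -> T})
    (M N : lmodType T^c) (f : {linear M -> N}) :
    {linear restriction u M -> restriction u N} :=
  projT1 (cid (restriction_linear u f)).

Lemma restriction_mapE (S T : pzRingType) (u : {rmorphism S -> T})
    (M N : lmodType T^c) (f : {linear M -> N}) x : restriction_map u f x = f x.
Proof. exact: (projT2 (cid (restriction_linear u f))). Qed.

Lemma restriction_acyclic (S T : pzRingType) (u : {rmorphism S -> T})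
    (X : nat -> lmodType T^c) (d : forall i, {linear X i -> X i.+1}) :
  acyclic d -> acyclic (fun i => restriction_map u (d i)).
Proof.
move=> [d0 ex]; split=> [x|i x]; rewrite restriction_mapE; first exact: d0.
by rewrite ex; split=> -[y ->]; exists y; rewrite restriction_mapE.
Qed.

Theorem theorem0p1 (Re : realType) (k : fieldType) (G : finGroupType)
    (R : algType k) (act : module_algebra G R)
    (G_nontrivial : (1 < #|G|)%N)
    (char_G : forall p : nat, p \in [pchar k]%R -> ~~ (p %| #|G|)%N)
    (R_noetherian : noetherian R)
    (R_gkdim : (gkdim Re R < +oo)%E)
    (a_AR : right_artin_rees (inv_radical act))
    (a_cofinal : cofinal (inv_radical act) (radical act))
    (R_CM : cohen_macaulay (radical act) (pertinency Re act)) :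
  cohen_macaulay (inv_radical act) (pertinency Re act).
Proof.
have noethR := R_noetherian.2.
have noethA := invariants_noetherian (act := act) char_G noethR.
have aL := @inv_radical_left_ideal _ _ _ act.
have aR := @inv_radical_right_ideal _ _ _ act.
have ARa := artin_rees_powers aL aR a_AR.
have [aL' _ adec _] := ARa.
have torsA (N : lmodType (invariants act)^c) := torsion_submodule N aL' adec.
have [J] := injective_resolution_exists (in_alg R) R^c^o.
have torsJ := restriction_torsion a_cofinal.
move=> i /R_CM R_CMi; case: i R_CMi => [|i] R_CMi.
  (* In degree 0 a torsion cycle comes from a torsion element [y] of $A$. Seen in $R$, [y] is
     torsion for the radical, and it vanishes by the hypothesis on $R$. *)
  apply: torsion_local_cohomology_zero0 => E x [n hn] /ires_exact0 [y xy].
  have y0 : val y = 0.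
    apply: (@iaug_inj _ _ J); rewrite raddf0.
    apply: (local_cohomology_zero0 R_CMi); last by apply/ires_exact0; exists (val y).
    apply: torsion_linear; apply/torsJ; exists n => c /hn.
    rewrite xy -linearZ /= -[X in _ = X](raddf0 (iaug E)) => /iaug_inj e.
    by have := congr1 val e.
  by rewrite xy (_ : y = 0) ?raddf0 //; apply: val_inj.
apply/(local_cohomology_zeroSP _ aR) => E.
have exX := augmented_acyclic E.
have exY := restriction_acyclic (inv_incl act) (augmented_acyclic J).
apply: (iffLR (exact_mod_torsionP (set_pow (inv_radical act)) i exX)).
(* In positive degrees $A$ is a retract of $R$ as a right $A$-module, by the inclusion and the
   Reynolds operator. *)
have [u uE] : exists u : {linear (invariants act)^c^o ->
    restriction (inv_incl act) R^c^o}, forall x, u x = val x.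
  by apply: make_linear => c x y.
have [v vE] : exists v : {linear restriction (inv_incl act) R^c^o ->
    (invariants act)^c^o}, forall x, v x = reynolds act x.
  by apply: make_linear => c x y; rewrite reynoldsD; congr (_ + _); exact: reynoldsMr.
apply: (@exact_mod_torsion_retract _ _ torsA (augmented E)
  (fun i => restriction (inv_incl act) (augmented J i)) _ _ u v i exX exY).
- by move=> j; apply: injective_injective_mod_torsion => //; exact: ires_inj.
- by move=> j; apply: restriction_injective_mod_torsion => //; exact: ires_inj.
- by move=> x; rewrite uE vE; exact: reynolds_val.
(* Back to torsion complexes: the one of [J] is the same over $A$ and over $R$, and over $R$ it is
   exact here by hypothesis. *)
apply: (iffRL (exact_mod_torsionP (set_pow (inv_radical act)) i exY)) => x /torsJ Tx.
rewrite restriction_mapE => dx.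
have rR := radical_right_ideal act.
have [y Ty ->] := (local_cohomology_zeroSP _ rR i).1 R_CMi J x Tx dx.
by exists y; [exact/torsJ|rewrite restriction_mapE].
Qed.
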